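(* Let $N\ge 1$, let $k_\omega>0$ and $k_v>0$ be arbitrary constants, and suppose that Assumptions 1, 2 and 3 (stated in the context) hold. Let $H=[h_{ij}]\in\mathbb{R}^{N\times N}$ be given by $h_{ij}=-a_{ij}$ for $i\ne j$ and $h_{ii}=\sum_{j=0}^N a_{ij}$. Then there exists $T^*>0$ such that, for every sampling period $T_0$ with $0<T_0<T^*$ and sampling instants $t_k=t_0+kT_0$, $k=0,1,2,\dots$, the origin of the sampled-data system on $\mathbb{R}^{3N}$ given, for $t\in[t_k,t_{k+1})$, by $$\dot{\bar\theta}(t)=-k_\omega H\bar\theta(t)-k_\omega H\hat\theta(t),$$ $$\dot{\bar x}(t)=-k_vH\bar x(t)+\omega_0(t)\bar y(t)-k_\omega\,\mathrm{diag}(\bar y(t))H\bar\theta(t_k)-k_\omega\tilde y_0(t)H\bar\theta(t_k)-k_vH\hat x(t),$$ $$\dot{\bar y}(t)=-\omega_0(t)\bar x(t)+k_\omega\,\mathrm{diag}(\bar x(t))H\bar\theta(t_k)+k_\omega\tilde x_0(t)H\bar\theta(t_k),$$ where $\hat\theta(t)=\bar\theta(t_k)-\bar\theta(t)$ and $\hat x(t)=\bar x(t_k)-\bar x(t)$, is uniformly globally asymptotically stable. Consequently, for such $T_0$, the distributed sampled-data control law $$\omega_i(t)=-k_\omega\sum_{j=0}^Na_{ij}\big(\theta_i(t_k)-\theta_j(t_k)\big)+\omega_0(t),\qquad v_i(t)=-k_v\sum_{j=0}^Na_{ij}\big(\tilde x_i(t_k)-\tilde x_j(t_k)\big)+v_0(t),\qquad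 t\in[t_k,t_{k+1}),\ i=1,\dots,N,$$ solves the leader-following cooperative tracking problem: for every initial time $t_0\ge0$ and all initial values $x_i(t_0),y_i(t_0),\theta_i(t_0)$, $i=1,\dots,N$, the trajectories of the follower robots under this control law exist for all $t\ge t_0$, and for every $i=1,\dots,N$, $$\lim_{t\to\infty}\big([x_i(t),y_i(t),\theta_i(t)]-[x_0(t),y_0(t),\theta_0(t)]\big)=0.$$
   Context: Follower robots $i=1,\dots,N$: $\dot x_i=v_i\cos\theta_i$, $\dot y_i=v_i\sin\theta_i$, $\dot\theta_i=\omega_i$, with states $x_i,y_i,\theta_i\in\mathbb{R}$ and control inputs $v_i,\omega_i\in\mathbb{R}$. Leader (index $0$): $\dot x_0=v_0(t)\cos\theta_0$, $\dot y_0=v_0(t)\sin\theta_0$, $\dot\theta_0=\omega_0(t)$, where $v_0(t),\omega_0(t)$ are given time-varying functions available to all robots, and $(x_0,y_0,\theta_0)$ is a given solution defined for $t\ge0$. Communication network: a directed graph $\bar{\mathcal G}=(\bar{\mathcal V},\bar{\mathcal E})$ with $\bar{\mathcal V}=\{0,1,\dots,N\}$; an edge $(j,i)\in\bar{\mathcal E}$ means robot $i$ can receive information from robot $j$. The weights $a_{ij}\ge0$ ($i=1,\dots,N$, $j=0,\dots,N$) satisfy $a_{ii}=0$ and, for $i\neq j$, $a_{ij}>0$ if and only if $(j,i)\in\bar{\mathcal E}$. Transformed coordinates, for $i=0,1,\dots,N$: $\tilde x_i=x_i\cos\theta_i+y_i\sin\theta_i$ and $\tilde y_i=-x_i\sin\theta_i+y_i\cos\theta_i$.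 Errors, for $i=1,\dots,N$: $\bar\theta_i=\theta_i-\theta_0$, $\bar x_i=\tilde x_i-\tilde x_0$, $\bar y_i=\tilde y_i-\tilde y_0$; $\bar\theta,\bar x,\bar y\in\mathbb{R}^N$ are the stacked vectors. The sampled-data system in the claim is the closed-loop error system obtained from the sampled-data control law; its solutions are continuous and satisfy the differential equations on each interval $[t_k,t_{k+1})$. For $\xi\in\mathbb{R}^N$, $\mathrm{diag}(\xi)$ is the diagonal matrix with diagonal entries $\xi_1,\dots,\xi_N$. Assumption 1: there is $M>0$ with $|x_0(t)|\le M$ and $|y_0(t)|\le M$ for all $t\ge0$. Assumption 2: $\omega_0$ is differentiable and there is $\bar\omega>0$ with $|\omega_0(t)|\le\bar\omega$ and $|\dot\omega_0(t)|\le\bar\omega$ for all $t\ge0$; moreover there are $T>0$ and $\mu>0$ with $\int_t^{t+T}\omega_0^2(\tau)\,d\tau\ge\mu$ for all $t\ge0$. Assumption 3: $\bar{\mathcal G}$ contains a directed spanning tree with node $0$ as its root. Uniform global asymptotic stability of the origin means: there is a class $\mathcal{KL}$ function $\beta$ such that every solution $z$ with initial time $t_0\ge0$ (the first sampling instant) satisfies $\|z(t)\|\le\beta(\|z(t_0)\|,t-t_0)$ for all $t\ge t_0$. *)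

(* Defs.v *)
From HB Require Import structures.
From mathcomp Require Import all_boot all_order all_algebra.
From mathcomp Require Import all_classical all_reals all_analysis.

Set Implicit Arguments.
Unset Strict Implicit.
Unset Printing Implicit Defensive.

Import Order.TTheory GRing.Theory Num.Theory.
Import numFieldNormedType.Exports.

Local Open Scope classical_set_scope.
Local Open Scope ring_scope.

(** Time functions are total on [R]; only their values at times [t >= 0]
    (resp. [t >= t0]) are ever constrained or used. *)

(** The difference quotient is restricted to [D], so this is the one-sided
    derivative at an endpoint of an interval [D] and the ordinary derivative at
    its interior points. *)
Definition deriv_in (R : realType) (D : set R) (f : R -> R) (t l : R) : Prop :=
  (fun s => (f s - f t) / (s - t)) @ within D (t^') --> l.

Definition continuous_from (R : realType) (t0 : R) (f : R -> R) : Prop :=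
  {within `[t0, +oo[, continuous f}.

(** ** Communication graph *)

Definition spanning_tree (V : finType) (e : rel V) (r : V) (t : rel V) : Prop :=
  [/\ subrel t e,
      forall u, ~~ t u r,
      forall v, v != r -> exists! u, t u v
    & forall v, connect t r v].

(** Nodes are ['I_N.+1]: the leader is [ord0] and the follower [i : 'I_N] is the
    node [lift ord0 i]. *)
Definition adjacency_weights (R : realType) (N : nat) (e : rel 'I_N.+1)
    (a : 'I_N -> 'I_N.+1 -> R) : Prop :=
  [/\ forall i j, 0 <= a i j,
      forall i : 'I_N, a i (lift ord0 i) = 0
    & forall (i : 'I_N) (j : 'I_N.+1), j != lift ord0 i ->
        (0 < a i j <-> e j (lift ord0 i))].

Definition Hmat (R : realType) (N : nat) (a : 'I_N -> 'I_N.+1 -> R) : 'M[R]_N :=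
  \matrix_(i, j) (if i == j then \sum_(l < N.+1) a i l
                  else - a i (lift ord0 j)).

(** ** Robots *)

Definition unicycle (R : realType) (D : set R) (v w x y th : R -> R) : Prop :=
  forall t : R, D t ->
    [/\ deriv_in D x t (v t * cos (th t)),
        deriv_in D y t (v t * sin (th t))
      & deriv_in D th t (w t)].

Definition tildex (R : realType) (x y th : R -> R) (t : R) : R :=
  x t * cos (th t) + y t * sin (th t).

Definition tildey (R : realType) (x y th : R -> R) (t : R) : R :=
  - x t * sin (th t) + y t * cos (th t).

Definition leader_bounded (R : realType) (x0 y0 : R -> R) : Prop :=
  exists2 M : R, 0 < M &
    forall t : R, 0 <= t -> `|x0 t| <= M /\ `|y0 t| <= M.

Definition leader_exciting (R : realType) (w0 : R -> R) : Prop :=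
  (exists2 wbar : R, 0 < wbar &
     exists dw0 : R -> R, forall t : R, 0 <= t ->
       [/\ deriv_in `[0, +oo[ w0 t (dw0 t),
           `|w0 t| <= wbar
         & `|dw0 t| <= wbar])
  /\
  (exists T mu : R, [/\ 0 < T, 0 < mu &
     forall t : R, 0 <= t ->
       (mu%:E <= \int[lebesgue_measure]_(s in `[t, (t + T)%R])
                   ((w0 s ^+ 2)%R)%:E)%E]).

(** ** Sampled-data error system *)

Definition sampling (R : realType) (t0 T0 : R) (k : nat) : R := t0 + k%:R * T0.

Definition sampling_interval (R : realType) (t0 T0 : R) (k : nat) : set R :=
  `[sampling t0 T0 k, sampling t0 T0 k.+1[.

(** The state is [z t = (thetabar; xbar; ybar)]. *)
Definition error_solution (R : realType) (N : nat) (H : 'M[R]_N) (kw kv : R)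
    (w0 tx0 ty0 : R -> R) (T0 t0 : R) (z : R -> 'cV[R]_(N + (N + N))) : Prop :=
  let th t : 'cV[R]_N := usubmx (z t) in
  let x t : 'cV[R]_N := usubmx (dsubmx (z t)) in
  let y t : 'cV[R]_N := dsubmx (dsubmx (z t)) in
  (forall i, continuous_from t0 (fun t => z t i ord0)) /\
  forall (k : nat) (t : R),
    let tk := sampling t0 T0 k in
    let D := sampling_interval t0 T0 k in
    let hatth := th tk - th t in
    let hatx := x tk - x t in
    let fth := - (kw *: (H *m th t)) - kw *: (H *m hatth) in
    let fx := - (kv *: (H *m x t)) + w0 t *: y t
              - kw *: (diag_mx (y t)^T *m H *m th tk)
              - (kw * ty0 t) *: (H *m th tk)
              - kv *: (H *m hatx) in
    let fy := - (w0 t *: x t)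
              + kw *: (diag_mx (x t)^T *m H *m th tk)
              + (kw * tx0 t) *: (H *m th tk) in
    D t -> forall i : 'I_N,
      [/\ deriv_in D (fun s => th s i ord0) t (fth i ord0),
          deriv_in D (fun s => x s i ord0) t (fx i ord0)
        & deriv_in D (fun s => y s i ord0) t (fy i ord0)].

(** ** Stability *)

(** The library norm on matrices is the sup norm. *)
Definition enorm (R : realType) (n : nat) (z : 'cV[R]_n) : R :=
  Num.sqrt (\sum_(i < n) z i ord0 ^+ 2).

Definition classKL (R : realType) (beta : R -> R -> R) : Prop :=
  [/\ {within [set p : R * R | 0 <= p.1 /\ 0 <= p.2],
         continuous (fun p : R * R => beta p.1 p.2)},
      forall s : R, 0 <= s -> beta 0 s = 0,
      forall s r r' : R, 0 <= s -> 0 <= r -> r < r' -> beta r s < beta r' s,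
      forall r s s' : R, 0 <= r -> 0 <= s -> s <= s' -> beta r s' <= beta r s
    & forall r : R, 0 <= r -> beta r s @[s --> +oo] --> (0 : R)].

(** [sol t0 z] reads: [z] is a solution with initial time [t0]. *)
Definition UGAS (R : realType) (n : nat)
    (sol : R -> (R -> 'cV[R]_n) -> Prop) : Prop :=
  exists2 beta : R -> R -> R, classKL beta &
    forall (t0 : R) (z : R -> 'cV[R]_n), 0 <= t0 -> sol t0 z ->
      forall t : R, t0 <= t -> enorm (z t) <= beta (enorm (z t0)) (t - t0).

(** ** Distributed control law *)

(** Extends a family indexed by the followers to all nodes. *)
Definition with_leader (T : Type) (N : nat) (f0 : T) (f : 'I_N -> T)
    (j : 'I_N.+1) : T :=
  oapp f f0 (unlift ord0 j).

(** [f j] is the signal received from node [j]; the feedback is evaluated at the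
    sampling instant [tk]. *)
Definition sampled_consensus (R : realType) (N : nat)
    (a : 'I_N -> 'I_N.+1 -> R) (f : 'I_N.+1 -> R -> R) (tk : R) (i : 'I_N) : R :=
  \sum_(j < N.+1) a i j * (f (lift ord0 i) tk - f j tk).

Definition closed_loop (R : realType) (N : nat) (a : 'I_N -> 'I_N.+1 -> R)
    (kw kv : R) (v0 w0 x0 y0 th0 : R -> R) (T0 t0 : R)
    (x y th : 'I_N -> R -> R) : Prop :=
  let thall := with_leader th0 th in
  let txall := with_leader (tildex x0 y0 th0)
                           (fun i => tildex (x i) (y i) (th i)) in
  forall i : 'I_N,
    [/\ continuous_from t0 (x i), continuous_from t0 (y i),
        continuous_from t0 (th i)
      & forall k : nat,
          let tk := sampling t0 T0 k in
          let w t := - kw * sampled_consensus a thall tk i + w0 t in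
          let v t := - kv * sampled_consensus a txall tk i + v0 t in
          unicycle (sampling_interval t0 T0 k) v w (x i) (y i) (th i)].

Definition solves_tracking (R : realType) (N : nat) (a : 'I_N -> 'I_N.+1 -> R)
    (kw kv : R) (v0 w0 x0 y0 th0 : R -> R) (T0 : R) : Prop :=
  forall (t0 : R) (xi yi thi : 'I_N -> R), 0 <= t0 ->
    let trajectory x y th :=
      closed_loop a kw kv v0 w0 x0 y0 th0 T0 t0 x y th /\
      (forall i, [/\ x i t0 = xi i, y i t0 = yi i & th i t0 = thi i]) in
    (exists x y th, trajectory x y th) /\
    (forall x y th, trajectory x y th -> forall i,
       [/\ x i t - x0 t @[t --> +oo] --> (0 : R),
           y i t - y0 t @[t --> +oo] --> (0 : R)
         & th i t - th0 t @[t --> +oo] --> (0 : R)]).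

(* Main.v *)
(** Let [u = - kw H thbar(t_k)] be the angular feedback, constant on each sampling
    interval. The heading errors obey [thbar_(k+1) = (1 - kw T0 H) thbar_k], hence
    decay geometrically, and so does [u].

    [H] is a nonsingular M-matrix, so some positive diagonal [P] makes
    [P H + H^T P] positive definite. For [V = x^T P x + y^T P y] the rotation terms
    [(w0 + u_i) y_i], [- (w0 + u_i) x_i] cancel robot by robot, whence
    [V' <= - c |x|^2] up to terms of order [T0] or [u]. Persistency of excitation
    upgrades [V] to the strict Lyapunov function
    [W = A V - T w0 x^T P y - Gam y^T P y] with
    [Gam t = int_t^(t+T) (t + T - s) w0(s)^2 ds], [Gam' >= mu - T w0^2].

    Comparing everything on [[t_k, t_(k+1)]] with its value at [t_k] yields
    [W_(k+1) <= (1 - lam T0) W_k + C (|u_k| W_k + |u_k|^2 + |u_k|^3)], and the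
    summability of [u_k] gives [|z(t)| <= K r e^(K r) e^(- lam (t - t0))] with
    [r = |z(t0)|]. *)

Require Import Defs.
From HB Require Import structures.
From mathcomp Require Import all_boot all_order all_algebra.
From mathcomp Require Import all_classical all_reals all_analysis.
From mathcomp Require Import ring lra.

Set Implicit Arguments.
Unset Strict Implicit.
Unset Printing Implicit Defensive.

Import Order.TTheory GRing.Theory Num.Theory.
Import numFieldNormedType.Exports.

Local Open Scope classical_set_scope.
Local Open Scope ring_scope.

(** * Diagonal stability of the network matrix *)

(** The threshold for [T0] must not depend on the initial state, although [u] scales with it. The
    perturbations are therefore sorted by kind. Terms of order [T0] times the energy are absorbed by
    dissipation, and this restricts the period. Terms carrying [u] may be large; they are never
    absorbed but are paid for through the geometric series. The bilinear term [|u_k| W_k] multiplies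
    the gain by an exponential of the total feedback, whence the factor [e^(K r)]: the rate is
    uniform, the gain in the bound grows with [r]. The cubic term appears because the size of the
    state on an interval is measured by [V + |u|^2]. The leader's position acts as a forcing
    [u_i * ty0], [- u_i * tx0], present even where the position errors vanish, so [V] alone cannot
    control the motion between samples. [P] has to be diagonal, and the same for [x] and [y]: only
    then does it commute with the rotation speeds [w0 + u_i], which differ from robot to robot. *)

Lemma exists_pos_lb (R : realFieldType) (I : finType) (f : I -> R) :
  (forall i, 0 < f i) -> exists2 c : R, 0 < c & forall i, c <= f i.
Proof.
move=> f0; have S0 : 0 <= \sum_i (f i)^-1 by apply: sumr_ge0 => i _; rewrite invr_ge0 ltW.
(* A harmonic sum replaces the minimum, so that an empty index type is covered too. *)
exists (1 + \sum_i (f i)^-1)^-1 => [|i]; first by rewrite invr_gt0; lra.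
rewrite -[leRHS]invrK lef_pV2 ?posrE ?invr_gt0 ?f0 //; last by lra.
rewrite (bigD1 i) //=.
have : 0 <= \sum_(j | j != i) (f j)^-1 by apply: sumr_ge0 => j _; rewrite invr_ge0 ltW.
by lra.
Qed.

Lemma exists_pos_ub (R : realFieldType) (I : finType) (f : I -> R) :
  exists2 C : R, 0 < C & forall i, `|f i| <= C.
Proof.
have S0 : 0 <= \sum_i `|f i| by apply: sumr_ge0.
exists (1 + \sum_i `|f i|) => [|i]; first by lra.
rewrite (bigD1 i) //=.
have : 0 <= \sum_(j | j != i) `|f j| by apply: sumr_ge0.
by lra.
Qed.

(** The depth is the length of a shortest tree path from the root. Deleting the last edge of such a
    path to [v] leaves a path to its predecessor, which is therefore strictly less deep. *)
Lemma spanning_tree_depth (V : finType) (e : rel V) (r : V) (t : rel V) :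
  spanning_tree e r t ->
  exists d : V -> nat, forall v, v != r -> exists2 u, e u v & (d u < d v)%N.
Proof.
move=> [te _ _ conn].
pose P v n := `[< exists p, [/\ path t r p, last r p = v & size p = n] >].
have exP v : exists n, P v n.
  have /connectP[p tp ->] := conn v.
  by exists (size p); apply/asboolP; exists p.
exists (fun v => ex_minn (exP v)) => v vr.
case: ex_minnP => n /asboolP[p [tp lp sp]] _.
case/lastP: p tp lp sp => [/= _ rv|p w]; first by rewrite rv eqxx in vr.
rewrite rcons_path last_rcons size_rcons => /andP[tp tw] <- sp.
exists (last r p); first exact: te.
rewrite -{}sp.
case: ex_minnP => m _ min.
by rewrite ltnS; apply: min; apply/asboolP; exists p.
Qed.

Section Mmatrix.
Variables (R : realType) (N : nat).
Implicit Types (H : 'M[R]_N) (x p q : 'I_N -> R).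

(** Vectors are functions of the index rather than columns, so that a family of signals [x i t]
    gives the vector [x^~ t] at time [t]. *)
Definition mxapp H x (i : 'I_N) : R := \sum_j H i j * x j.

Lemma mxappD H x y i : mxapp H (fun j => x j + y j) i = mxapp H x i + mxapp H y i.
Proof. by rewrite -big_split; apply: eq_bigr => j _; rewrite mulrDr. Qed.

Lemma mxappZ H c x i : mxapp H (fun j => c * x j) i = c * mxapp H x i.
Proof. by rewrite big_distrr; apply: eq_bigr => j _; rewrite mulrCA. Qed.

(** Graph Laplacian form: an error coordinate is zero at the leader, whose weight therefore shows up
    only in the diagonal entry of [H]. *)
Lemma mxapp_Hmat (a : 'I_N -> 'I_N.+1 -> R) x i :
  a i (lift ord0 i) = 0 ->
  mxapp (Hmat a) x i = \sum_(j < N.+1) a i j * (x i - with_leader 0 x j).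
Proof.
move=> aii; rewrite /mxapp (bigD1 i) //= mxE eqxx.
under [in RHS]eq_bigr do rewrite mulrBr.
rewrite sumrB -mulr_suml; congr (_ + _).
rewrite big_ord_recl {1}/with_leader unlift_none /= mulr0 add0r.
rewrite [X in _ = - X](bigD1 i) //= aii mul0r add0r -sumrN; apply: eq_bigr => j ji.
by rewrite /with_leader liftK /= mxE eq_sym (negbTE ji) mulNr.
Qed.

(** The test vector is [1 - ep ^ depth], whose differences are [ep ^ d j - ep ^ d i]. A less deep
    in-neighbour [f i] contributes at least [al * ep ^ (d i - 1)], while the negative parts of the
    row add up to at most [A * ep ^ d i], which is smaller once [A * ep < al]. *)
Lemma Hmat_row_positive (e : rel 'I_N.+1) (a : 'I_N -> 'I_N.+1 -> R) :
  adjacency_weights e a ->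
  (exists t : rel 'I_N.+1, spanning_tree e ord0 t) ->
  exists q, forall i, 0 < q i /\ 0 < mxapp (Hmat a) q i.
Proof.
move=> [a0 aii ae] [t /spanning_tree_depth[d hd]].
have /boolp.choice[f hf] : forall i : 'I_N, exists j, 0 < a i j /\ (d j < d (lift ord0 i))%N.
  move=> i; have [//|j ej dj] := hd (lift ord0 i).
  exists j; split=> //; apply/ae => //.
  by apply: contraTneq dj => ->; rewrite ltnn.
have [al al0 hal] := @exists_pos_lb R _ (fun i => a i (f i)) (fun i => (hf i).1).
have [A A0 hA] := @exists_pos_ub R _ (fun i => \sum_j a i j).
pose ep := al / (al + 2 * A).
have ep0 : 0 < ep by rewrite divr_gt0 //; lra.
have ep1 : ep < 1 by rewrite ltr_pdivrMr ?mul1r; lra.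
have Aep : A * ep < al.
  by rewrite /ep mulrA ltr_pdivrMr ?[A * al]mulrC ?ltr_pM2l //; lra.
exists (fun i => 1 - ep ^+ d (lift ord0 i)) => i.
have [aif dif] := hf i; have [n dn] : exists n, d (lift ord0 i) = n.+1.
  by exists (d (lift ord0 i)).-1; rewrite prednK // (leq_ltn_trans _ dif).
split.
  by rewrite subr_gt0 dn exprn_ilt1 // ltW.
rewrite mxapp_Hmat //.
have Dn : 0 < ep ^+ n by rewrite exprn_gt0.
(* The leader's value 0 is at most [1 - ep ^ d ord0], so treating the leader like any other node
   only lowers the row sum. *)
apply: (@lt_le_trans _ _ (\sum_(j < N.+1) a i j * (ep ^+ d j - ep ^+ d (lift ord0 i)))).
  under eq_bigr do rewrite mulrBr.
  rewrite sumrB -mulr_suml (bigD1 (f i)) //=.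
  have S0 : 0 <= \sum_(j < N.+1 | j != f i) a i j * ep ^+ d j.
    by apply: sumr_ge0 => j _; rewrite mulr_ge0 // exprn_ge0 // ltW.
  have L : al * ep ^+ n <= a i (f i) * ep ^+ d (f i).
    apply: ler_pM => //; [exact: ltW|exact: ltW|].
    by rewrite ler_wiXn2l ?(ltW ep0) ?(ltW ep1) // -ltnS -dn.
  have U : (\sum_(j < N.+1) a i j) * ep ^+ d (lift ord0 i) <= A * ep * ep ^+ n.
    rewrite dn exprS mulrA ler_pM2r // ler_pM2r //.
    exact: le_trans (ler_norm _) (hA i).
  have : A * ep * ep ^+ n < al * ep ^+ n by rewrite ltr_pM2r.
  by lra.
apply: ler_sum => j _; apply: ler_wpM2l => //.
rewrite /with_leader; case: unliftP => [k ->|->] /=; first by lra.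
have : ep ^+ d ord0 <= 1 by rewrite exprn_ile1 // ltW.
by lra.
Qed.

(** Minimum principle. Let [i] minimise [x i / q i] and let [m] be that ratio. Then [x - m q] is
    nonnegative and vanishes at [i], so row [i] of [H] maps it to a nonpositive number; if [m < 0],
    adding [m * (H q) i < 0] contradicts [0 <= (H x) i]. *)
Lemma inverse_positive H q x :
  (forall i j, i != j -> H i j <= 0) ->
  (forall i, 0 < q i /\ 0 < mxapp H q i) ->
  (forall i, 0 <= mxapp H x i) -> forall i, 0 <= x i.
Proof.
move=> H0 Hq Hx i0; rewrite leNgt; apply/negP => x0.
case: (@arg_minP _ R _ i0 xpredT (fun i => x i / q i)) => // i _ min.
have qi := (Hq i).1.
have m0 : x i / q i < 0.
  by apply: le_lt_trans (min i0 isT) _; rewrite pmulr_llt0 // invr_gt0; case: (Hq i0).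
have xE : mxapp H x i = (x i / q i) * mxapp H q i
                        + mxapp H (fun j => x j - x i / q i * q j) i.
  rewrite -mxappZ -mxappD; congr mxapp; apply/funext => j; lra.
have := Hx i; rewrite xE leNgt => /negP; apply.
rewrite -[ltRHS]addr0; apply: ltr_leD.
  by rewrite pmulr_llt0 //; case: (Hq i).
apply: sumr_le0 => j _; have [<-|ij] := eqVneq i j.
  by rewrite divfK ?gt_eqF // subrr mulr0.
rewrite mulr_le0_ge0 ?H0 // subr_ge0 -ler_pdivlMr ?min //; by case: (Hq j).
Qed.

(** Inverse positivity applied to [v] and [- v] makes [H] injective, and applied to the columns of
    the inverse [G] makes [G] entrywise nonnegative. The column sums of [G] then satisfy
    [p^T H = 1^T], and none is zero because no column of an inverse vanishes. *)
Lemma column_positive H q :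
  (forall i j, i != j -> H i j <= 0) ->
  (forall i, 0 < q i /\ 0 < mxapp H q i) ->
  exists p, forall j, 0 < p j /\ 0 < \sum_i p i * H i j.
Proof.
move=> H0 Hq; have inj := inverse_positive H0 Hq.
have Hu : H \in unitmx.
  rewrite -unitmx_tr -row_free_unit; apply: inj_row_free => v vH.
  have Hv i : mxapp H (fun j => v ord0 j) i = 0.
    have /rowP/(_ i) := vH; rewrite !mxE => <-.
    by apply: eq_bigr => j _; rewrite mxE mulrC.
  apply/rowP => j; rewrite mxE; apply/eqP; rewrite eq_le -oppr_ge0.
  rewrite (inj (fun j => v ord0 j)) ?andbT => [|i]; last by rewrite Hv.
  apply: (inj (fun j => - v ord0 j)) => i.
  have := mxappZ H (-1) (fun j => v ord0 j) i; rewrite Hv mulr0.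
  rewrite (_ : (fun j => -1 * v ord0 j) = fun j => - v ord0 j) => [->//|].
  by apply/funext => k; rewrite mulN1r.
pose G := invmx H.
have HG i k : mxapp H (fun j => G j k) i = (i == k)%:R.
  by have /matrixP/(_ i k) := mulmxV Hu; rewrite !mxE.
have G0 j k : 0 <= G j k.
  by apply: (inj (fun j => G j k)) => i; rewrite HG; case: (_ == _).
exists (fun i => \sum_j G j i) => j; split.
  rewrite lt_neqAle sumr_ge0 // andbT eq_sym; apply/negP => /eqP/psumr_eq0P z.
  have := HG j j; rewrite eqxx /mxapp big1 => [/esym/eqP|i _]; first by rewrite oner_eq0.
  by rewrite z ?mulr0.
rewrite (_ : \sum_i _ = 1) //.
under eq_bigr do rewrite mulr_suml.
rewrite exchange_big /=.
transitivity (\sum_i (i == j)%:R : R); last first.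
  by rewrite (bigD1 j) //= eqxx big1 ?addr0 // => i /negbTE->.
apply: eq_bigr => i _.
by have /matrixP/(_ i j) := mulVmx Hu; rewrite !mxE.
Qed.

(* With [p = p' / q], [H q > 0] and [p'^T H > 0], the matrix
   [B = diag p' * H * diag q] has positive row and column sums, so [B + B^T] is
   strictly diagonally dominant. *)
Lemma diagonal_stability H q :
  (forall i j, i != j -> H i j <= 0) ->
  (forall i, 0 < q i /\ 0 < mxapp H q i) ->
  exists2 p, (forall i, 0 < p i) &
    exists2 c : R, 0 < c &
      forall x, c * \sum_i p i * x i ^+ 2 <= \sum_i p i * (x i * mxapp H x i).
Proof.
move=> H0 Hq; have [p' Hp'] := column_positive H0 Hq.
have q0 i : 0 < q i by case: (Hq i).
have p'0 i : 0 < p' i by case: (Hp' i).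
pose p i := p' i / q i.
have p0 i : 0 < p i by rewrite divr_gt0.
(* Half the sum of the [i]-th row and column sums of [B], divided by the weight that turns
   [z i ^+ 2] into [p i * x i ^+ 2]. *)
pose g i := (p' i * mxapp H q i + (\sum_k p' k * H k i) * q i) / (2 * p i * q i ^+ 2).
have [|c c0 cg] := @exists_pos_lb R _ g.
  move=> i; apply: divr_gt0; last by apply: mulr_gt0; [apply: mulr_gt0|apply: exprn_gt0].
  by rewrite addr_gt0 // mulr_gt0 //; [case: (Hq i)|case: (Hp' i)].
exists p => //; exists c => // x.
pose z i := x i / q i.
have xE i : x i = q i * z i by rewrite mulrC divfK // gt_eqF.
(* Off the diagonal the entries of [B] are nonpositive, so replacing [z i * z j] by the larger mean
   of the squares lowers the form; on the diagonal the two agree. *)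
apply: (@le_trans _ _ (\sum_i \sum_j p' i * H i j * q j * ((z i ^+ 2 + z j ^+ 2) / 2))).
  rewrite (_ : \sum_i \sum_j _ = \sum_i
    ((p' i * mxapp H q i + (\sum_k p' k * H k i) * q i) / 2 * z i ^+ 2)); last first.
    under eq_bigr => i _.
      under eq_bigr => j _ do rewrite mulrDl mulrDr.
      rewrite big_split /=; over.
    rewrite big_split /= [X in _ + X]exchange_big /= -big_split /=.
    apply: eq_bigr => i _.
    rewrite mulrDl mulrDl !mulr_suml /mxapp mulr_sumr !mulr_suml.
    by congr (_ + _); apply: eq_bigr => j _; ring.
  rewrite mulr_sumr; apply: ler_sum => i _.
  rewrite xE exprMn; have := cg i; rewrite /g ler_pdivlMr => [h|]; last first.
    by apply: mulr_gt0; [apply: mulr_gt0|apply: exprn_gt0].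
  have := ler_wpM2r (sqr_ge0 (z i)) h; lra.
apply: ler_sum => i _; rewrite /mxapp mulr_sumr mulr_sumr; apply: ler_sum => j _.
have -> : p i * (x i * (H i j * x j)) = p' i * H i j * q j * (z i * z j).
  rewrite [x j]xE /p /z; field; by rewrite !gt_eqF.
have [<-|ij] := eqVneq i j.
  by rewrite (_ : (z i ^+ 2 + z i ^+ 2) / 2 = z i * z i) //; field.
apply: ler_wnM2l.
  by rewrite -mulrA mulr_ge0_le0 ?(ltW (p'0 _)) // mulr_le0_ge0 ?H0 ?(ltW (q0 _)).
have := sqr_ge0 (z i - z j); lra.
Qed.

Lemma mxapp_bound H : exists2 h : R, 0 < h & forall x m i,
  (forall j, `|x j| <= m) -> `|mxapp H x i| <= h * m.
Proof.
have [h h0 Hh] := @exists_pos_ub R _ (fun i => \sum_j `|H i j|).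
exists h => // x m i xm.
have m0 : 0 <= m by apply: le_trans (xm i).
apply: le_trans (ler_norm_sum _ _ _) _.
apply: (@le_trans _ _ ((\sum_j `|H i j|) * m)).
  by rewrite mulr_suml; apply: ler_sum => j _; rewrite normrM ler_wpM2l.
apply: ler_wpM2r => //; exact: le_trans (ler_norm _) (Hh i).
Qed.

Lemma weighted_entry_bound p x s :
  (forall i, 0 < p i) -> \sum_i p i * x i ^+ 2 <= s -> forall i, p i * x i ^+ 2 <= s.
Proof.
move=> p0 h i; apply: le_trans h; rewrite (bigD1 i) //= lerDl.
by apply: sumr_ge0 => j _; rewrite mulr_ge0 ?sqr_ge0 // ltW.
Qed.

Lemma weighted_mxapp_bound H p : (forall i, 0 < p i) ->
  exists2 K : R, 0 < K & forall x,
    \sum_i p i * mxapp H x i ^+ 2 <= K * \sum_i p i * x i ^+ 2.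
Proof.
move=> p0; have [h h0 Hh] := mxapp_bound H.
have [pm pm0 Hpm] := @exists_pos_lb R _ p p0.
(* A one-element family gives a strictly positive bound of the sum even when the sum is empty. *)
have [P P0 HP] := @exists_pos_ub R 'I_1 (fun=> \sum_i p i).
exists (P * (h ^+ 2 / pm)) => [|x]; first by rewrite !mulr_gt0 ?invr_gt0 ?exprn_gt0.
set X := \sum_i p i * x i ^+ 2.
have X0 : 0 <= X by apply: sumr_ge0 => i _; rewrite mulr_ge0 ?sqr_ge0 ?ltW.
have xb j : `|x j| <= Num.sqrt (X / pm).
  rewrite -sqrtr_sqr ler_wsqrtr // ler_pdivlMr // mulrC.
  apply: le_trans (@weighted_entry_bound p x X p0 (lexx _) j).
  by rewrite ler_wpM2r ?sqr_ge0.
have Xp : 0 <= X / pm by rewrite divr_ge0 // ltW.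
apply: (@le_trans _ _ ((\sum_i p i) * (h ^+ 2 * (X / pm)))).
  rewrite mulr_suml; apply: ler_sum => i _; apply: ler_wpM2l; first exact: ltW.
  have -> : h ^+ 2 * (X / pm) = (h * Num.sqrt (X / pm)) ^+ 2 by rewrite exprMn sqr_sqrtr.
  rewrite -real_normK ?num_real // lerXn2r ?nnegrE ?mulr_ge0 ?sqrtr_ge0 ?(ltW h0) //.
  exact: Hh.
have -> : P * (h ^+ 2 / pm) * X = P * (h ^+ 2 * (X / pm)) by ring.
apply: ler_wpM2r; first by rewrite mulr_ge0 ?sqr_ge0.
exact: le_trans (ler_norm _) (HP ord0).
Qed.

(** Expanding the square gives the factor [1 - 2 * tau * c + tau ^+ 2 * K], and [tau * K <= c] lets
    half of the linear gain pay for the quadratic loss. *)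
Lemma euler_contraction H p c K x tau :
  (forall i, 0 < p i) ->
  c * (\sum_i p i * x i ^+ 2) <= \sum_i p i * (x i * mxapp H x i) ->
  \sum_i p i * mxapp H x i ^+ 2 <= K * (\sum_i p i * x i ^+ 2) ->
  0 <= tau -> tau * K <= c ->
  \sum_i p i * (x i - tau * mxapp H x i) ^+ 2
    <= (1 - tau * c) * \sum_i p i * x i ^+ 2.
Proof.
move=> p0 hc hK t0 tK.
have -> : \sum_i p i * (x i - tau * mxapp H x i) ^+ 2 =
   \sum_i p i * x i ^+ 2 - 2 * tau * (\sum_i p i * (x i * mxapp H x i))
   + tau ^+ 2 * \sum_i p i * mxapp H x i ^+ 2.
  rewrite !mulr_sumr -sumrB -big_split /=; apply: eq_bigr => i _; ring.
set X := \sum_i p i * x i ^+ 2 in hc hK *.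
have X0 : 0 <= X by apply: sumr_ge0 => i _; rewrite mulr_ge0 ?sqr_ge0 ?ltW.
have h1 := ler_wpM2l t0 hc.
have h2 := ler_wpM2l (sqr_ge0 tau) hK.
have h3 := ler_wpM2r (mulr_ge0 t0 X0) tK.
by rewrite expr2 in h2 *; lra.
Qed.

End Mmatrix.

(** * One-sided derivatives and antiderivatives *)

Section Derivatives.
Variable R : realType.
Implicit Types (D : set R) (f g : R -> R).

(** Caratheodory's criterion: the quotient, completed by [l] at [t], is continuous there. It links
    the library derivative to [deriv_in]. *)
Lemma is_derive_quotientP f (t l : R) :
  is_derive t 1 f l <-> (fun s => (f s - f t) / (s - t)) @ t^' --> l.
Proof.
split=> [/is_derive1_caratheodory[g [fg /continuous_withinNx cg <-]]|cf].
  apply: cvg_trans cg; apply: near_eq_cvg; near=> s.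
  have st : s != t by near: s; exact: nbhs_dnbhs_neq.
  by rewrite fg mulfK // subr_eq0.
apply/is_derive1_caratheodory.
exists (fun s => if s == t then l else (f s - f t) / (s - t)); split.
- move=> z; case: eqP => [->|/eqP zt]; first by rewrite !subrr mulr0.
  by rewrite divfK // subr_eq0.
- apply/continuous_withinNx; rewrite eqxx; apply: cvg_trans cf.
  apply: near_eq_cvg; near=> s.
  have st : s != t by near: s; exact: nbhs_dnbhs_neq.
  by rewrite (negbTE st).
- by rewrite eqxx.
Unshelve. all: by end_near. Qed.

Lemma is_derive_deriv_in D f (t l : R) : is_derive t 1 f l -> deriv_in D f t l.
Proof.
move=> /is_derive_quotientP h; apply: cvg_trans h; apply: cvg_app.
exact: cvg_within.
Qed.

Lemma deriv_in_is_derive D f (t l : R) :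
  nbhs t D -> deriv_in D f t l -> is_derive t 1 f l.
Proof.
move=> tD h; apply/is_derive_quotientP; apply: cvg_trans h; apply: cvg_app => A hA.
have tD' : t^' D by exact: nbhs_dnbhs.
by apply: (@filterS2 _ (t^') _ _ _ _ _ hA tD') => s h /h.
Qed.

Lemma eq_deriv_in D f g (t l : R) :
  (forall s, D s -> f s = g s) -> D t -> deriv_in D f t l -> deriv_in D g t l.
Proof.
move=> fg Dt; apply: cvg_trans; apply: near_eq_cvg.
apply: (@filterE _ (t^')) => s Ds; by rewrite !fg.
Qed.

Lemma nbhs_oo (a b t : R) D : `]a, b[ `<=` D -> a < t -> t < b -> nbhs t D.
Proof.
move=> abD ta tb; apply: filterS abD _.
by apply: near_in_itvoo; rewrite in_itv /= ta tb.
Qed.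

Lemma nbhs_oy (a t : R) D : `]a, +oo[ `<=` D -> a < t -> nbhs t D.
Proof.
by move=> abD ta; apply: filterS abD _; apply: near_in_itvoy; rewrite in_itv /= ta.
Qed.

Lemma is_derive_continuous f (t l : R) : is_derive t 1 f l -> {for t, continuous f}.
Proof. by case=> df _; apply: differentiable_continuous; apply/derivable1_diffP. Qed.

Lemma mvt_bounds f df (a b m M : R) : a <= b ->
  (forall t : R, a < t -> t < b -> is_derive t 1 f (df t)) ->
  {within `[a, b], continuous f} ->
  (forall t, a < t -> t < b -> m <= df t <= M) ->
  m * (b - a) <= f b - f a <= M * (b - a).
Proof.
rewrite le_eqVlt => /predU1P[->|ab] hf cf hM; first by rewrite !subrr !mulr0 lexx.
have [t|c] := MVT (df := df) ab _ cf.
  by rewrite in_itv /= => /andP[? ?]; exact: hf.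
rewrite in_itv /= => /andP[ac cb] ->; have /andP[h1 h2] := hM _ ac cb.
by rewrite !ler_wpM2r // subr_ge0 ltW.
Qed.

Lemma mvt_norm f df (a b M : R) : a <= b ->
  (forall t : R, a < t -> t < b -> is_derive t 1 f (df t)) ->
  {within `[a, b], continuous f} ->
  (forall t, a < t -> t < b -> `|df t| <= M) ->
  `|f b - f a| <= M * (b - a).
Proof.
move=> ab hf cf hM; rewrite ler_norml -mulNr.
by apply: mvt_bounds hf cf _ => // t ta tb; rewrite -ler_norml hM.
Qed.

Lemma mvt_le f df (a b M : R) : a <= b ->
  (forall t : R, a < t -> t < b -> is_derive t 1 f (df t)) ->
  {within `[a, b], continuous f} ->
  (forall t, a < t -> t < b -> df t <= M) ->
  f b - f a <= M * (b - a).
Proof.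
rewrite le_eqVlt => /predU1P[->|ab] hf cf hM; first by rewrite !subrr !mulr0 lexx.
have [t|c] := MVT (df := df) ab _ cf.
  by rewrite in_itv /= => /andP[? ?]; exact: hf.
rewrite in_itv /= => /andP[ac cb] ->.
by rewrite ler_wpM2r ?hM // subr_ge0 ltW.
Qed.

(** To the left of 0 the function is continued by its tangent at 0. The result has a two-sided
    derivative everywhere, with the slope [df 0] at negative times. *)
Lemma deriv_in_extend f (df : R -> R) :
  (forall t, 0 <= t -> deriv_in `[0, +oo[ f t (df t)) ->
  exists g, (forall t, 0 <= t -> g t = f t) /\
    forall t : R, is_derive t 1 g (df (Num.max 0 t)).
Proof.
move=> hf; pose g t := if 0 <= t then f t else f 0 + df 0 * t.
exists g; split=> [t t0|t]; first by rewrite /g t0.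
have [t0|t0|t0] := ltgtP t 0.
- apply: (@near_eq_is_derive _ _ _ (fun s => f 0 + df 0 * s)).
    near=> s; rewrite /g leNgt ifN // negbK; near: s; exact: lt_nbhsl.
  apply: is_derive_eq; rewrite /GRing.scale /=; ring.
- apply: (@near_eq_is_derive _ _ _ f).
    near=> s; rewrite /g ifT // ltW //; near: s; exact: lt_nbhsr.
  apply: deriv_in_is_derive (hf _ (ltW t0)).
  by apply: (@nbhs_oy 0) => // s /=; rewrite !in_itv /= !andbT => /ltW.
- rewrite t0; apply/is_derive_quotientP/cvgrPdist_lt => e e0.
  have /cvgrPdist_lt /(_ e e0) := hf 0 (lexx _); rewrite near_withinE => h.
  near=> s.
  have sn0 : s != 0 by near: s; exact: nbhs_dnbhs_neq.
  rewrite /g lexx; case: ifPn => [s0|].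
    have sI : `[0, +oo[%classic s by rewrite /= in_itv /= s0.
    by move: sI; near: s.
  rewrite -ltNge => s0; rewrite [f 0 + _]addrC addrK subr0 mulfK // subrr normr0 //.
Unshelve. all: by end_near. Qed.

Lemma antiderivative f : continuous f ->
  exists F, forall t : R, 0 <= t -> is_derive t 1 F (f t).
Proof.
(* The base point -1 makes time 0 an interior point of the interval of integration. *)
move=> cf; exists (fun y => \int[lebesgue_measure]_(t in `[-1, y]) f t) => t t0.
have [||||dF dFE] := @continuous_FTC1_closed R f (-1) t (t + 1).
- by rewrite ltrDl.
- apply: continuous_compact_integrable; first exact: segment_compact.
  exact: continuous_subspaceT.
- by lra.
- exact: cf.
by apply: DeriveDef; [exact: dF|rewrite -derive1E; exact: dFE].
Qed.

Lemma integral_antiderivative f F (a b : R) : continuous f -> 0 <= a -> a < b ->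
  (forall t : R, 0 <= t -> is_derive t 1 F (f t)) ->
  (\int[lebesgue_measure]_(s in `[a, b]) (f s)%:E = (F b - F a)%:E)%E.
Proof.
move=> cf a0 ab dF; rewrite (continuous_FTC2 (F := F)) //.
- exact: continuous_subspaceT.
- have cF t : 0 <= t -> {for t, continuous F} by move=> /dF; exact: is_derive_continuous.
  split.
  + move=> t; rewrite in_itv /= => /andP[ta _].
    by have [] := dF t (ltW (le_lt_trans a0 ta)).
  + exact/cvg_at_right_filter/cF.
  + by apply/cvg_at_left_filter/cF; rewrite (le_trans a0) // ltW.
- move=> t; rewrite in_itv /= => /andP[ta _]; rewrite derive1E.
  by have [_ ->] := dF t (ltW (le_lt_trans a0 ta)).
Qed.

(* [Gam t] is the integral over [t, t + T] of [(t + T - s) * w0 s ^+ 2]. *)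
Lemma exciting_weight (w0 : R -> R) : leader_exciting w0 ->
  exists (w dw Gam dGam : R -> R) (wb T mu G : R),
    [/\ 0 < wb, 0 < T, 0 < mu, 0 < G &
     forall t, 0 <= t ->
      [/\ w t = w0 t, is_derive t 1 w (dw t) & is_derive t 1 Gam (dGam t)] /\
      [/\ `|w t| <= wb, `|dw t| <= wb, `|Gam t| <= G
        & mu - T * w t ^+ 2 <= dGam t]].
Proof.
move=> [[wb wb0 [dw0 hw]] [T [mu [T0 mu0 PE]]]].
have [w [ww0 dw]] := @deriv_in_extend w0 dw0 (fun t t0 => let: And3 h _ _ := hw t t0 in h).
have cw : continuous w by move=> t; exact: is_derive_continuous (dw t).
have cw2 : continuous (fun t => w t ^+ 2) by move=> t; apply: cvgM; exact: cw.
have [F dF] := antiderivative cw2.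
have cF t : 0 <= t -> {for t, continuous F} by move=> /dF; exact: is_derive_continuous.
(* [F] is controlled only for nonnegative times; freezing it to the left of 0 gives a globally
   continuous integrand for a second antiderivative. *)
pose Fe t := F (Num.max 0 t).
have cFe : continuous Fe.
  move=> t; have cm : {for t, continuous (fun s : R => Num.max 0 s)}.
    by apply: continuous_max; [exact: cst_continuous|exact: cvg_id].
  by apply: (continuous_comp cm); apply: cF; rewrite le_max lexx.
have [G dG] := antiderivative cFe.
have FeE t : 0 <= t -> Fe t = F t by move=> t0; rewrite /Fe max_r.
have cG t : 0 <= t -> {for t, continuous G} by move=> /dG; exact: is_derive_continuous.
have wle t : 0 <= t -> 0 <= w t ^+ 2 <= wb ^+ 2.
  move=> t0; rewrite sqr_ge0 /= -real_normK ?num_real // lerXn2r ?nnegrE ?(ltW wb0) //.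
  by rewrite ww0 //; have [] := hw t t0.
have within_cont (h : R -> R) a b : 0 <= a -> (forall t, 0 <= t -> {for t, continuous h}) ->
    {within `[a, b], continuous h}.
  move=> a0 ch; apply: continuous_in_subspaceT => s; rewrite inE /= in_itv /= => /andP[sa _].
  exact: ch (le_trans a0 sa).
have Fle s t : 0 <= t -> t <= s -> 0 <= F s - F t <= wb ^+ 2 * (s - t).
  move=> t0 ts; rewrite -[X in X <= _](mul0r (s - t)).
  apply: (mvt_bounds (df := fun t => w t ^+ 2)) => //.
  - by move=> r tr _; apply: dF; rewrite ltW // (le_lt_trans t0 tr).
  - exact: within_cont.
  - by move=> r tr _; apply: wle; rewrite ltW // (le_lt_trans t0 tr).
(* Integration by parts turns the weighted integral into [G (t + T) - G t - T * F t] with [G' = F]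
   and [F' = w ^+ 2]. Its derivative contains [F (t + T) - F t], which is the excitation integral
   and hence at least [mu]. *)
exists w, (fun t => dw0 (Num.max 0 t)), (fun t => G (t + T) - G t - T * F t),
  (fun t => F (t + T) - F t - T * w t ^+ 2), wb, T, mu, (wb ^+ 2 * T * T).
split=> //; first by rewrite !mulr_gt0.
move=> t t0; have tT0 : 0 <= t + T by rewrite addr_ge0 // ltW.
have tT : t <= t + T by rewrite lerDl ltW.
split; split.
- exact: ww0.
- exact: dw.
- have h1 := dG _ t0; have h2 := dF _ t0.
  have h3 : is_derive t 1 (fun s => G (s + T)) (Fe (t + T) * 1).
    apply: (@is_derive1_comp _ G (shift T)); last exact: is_derive_shift.
    exact: dG.
  apply: is_derive_eq; rewrite !FeE // /GRing.scale /=; ring.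
- by rewrite ww0 //; have [] := hw t t0.
- by rewrite max_r //; have [] := hw t t0.
- have /andP[h1 h2] : F t * ((t + T) - t) <= G (t + T) - G t
                      <= (F t + wb ^+ 2 * T) * ((t + T) - t).
    apply: (mvt_bounds (df := Fe)) => //.
    + by move=> r tr _; apply: dG; rewrite ltW // (le_lt_trans t0 tr).
    + exact: within_cont.
    + move=> r tr rT; have r0 : 0 <= r by rewrite ltW // (le_lt_trans t0 tr).
      rewrite FeE //; have /andP[h1 h2] := Fle r t t0 (ltW tr).
      have : wb ^+ 2 * (r - t) <= wb ^+ 2 * T by rewrite ler_wpM2l ?sqr_ge0 //; lra.
      lra.
  by rewrite ger0_norm; lra.
- have := PE t t0.
  have -> : (\int[lebesgue_measure]_(s in `[t, (t + T)%R]) ((w0 s ^+ 2)%R)%:E =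
             \int[lebesgue_measure]_(s in `[t, (t + T)%R]) ((w s ^+ 2)%R)%:E)%E.
    apply: eq_integral => s; rewrite inE /= in_itv /= => /andP[ts _]; rewrite ww0 //.
    exact: le_trans t0 ts.
  rewrite (integral_antiderivative (F := F)) ?lee_fin ?ltrDl //.
  lra.
Qed.

End Derivatives.

(** * The strict Lyapunov function *)

Lemma normM_le (R : realType) (x y a b : R) : `|x| <= a -> `|y| <= b -> `|x * y| <= a * b.
Proof. by move=> xa yb; rewrite normrM ler_pM. Qed.

Lemma is_derive_mul (R : realType) (f g : R -> R) (t df dg : R) :
  is_derive t 1 f df -> is_derive t 1 g dg ->
  is_derive t 1 (fun s => f s * g s) (df * g t + f t * dg).
Proof.
move=> hf hg; have h := is_deriveM hf hg.
by apply: (is_derive_eq h); rewrite /GRing.scale /=; ring.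
Qed.

Lemma is_derive_wsum (R : realType) (N : nat) (p : 'I_N -> R)
    (f : 'I_N -> R -> R) (df : 'I_N -> R) (t : R) :
  (forall i, is_derive t 1 (f i) (df i)) ->
  is_derive t 1 (fun s => \sum_i p i * f i s) (\sum_i p i * df i).
Proof.
move=> hf; rewrite (_ : (fun s => _) = \sum_i (p i *: f i)).
  by apply: is_derive_sum => i; exact: is_deriveZ.
by apply/funext => s; rewrite fct_sumE.
Qed.

Lemma continuous_wsum (R : realType) (N : nat) (D : set R) (p : 'I_N -> R)
    (f : 'I_N -> R -> R) :
  (forall i, {within D, continuous f i}) ->
  {within D, continuous (fun s => \sum_i p i * f i s)}.
Proof.
move=> hf s; apply: cvg_big => [|i _]; first by apply: add_continuous.
by apply: cvgM; [exact: cvg_cst|exact: hf].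
Qed.

Lemma within_continuousM (R : realType) (D : set R) (f g : R -> R) :
  {within D, continuous f} -> {within D, continuous g} ->
  {within D, continuous (fun s => f s * g s)}.
Proof. by move=> hf hg s; apply: cvgM; [exact: hf|exact: hg]. Qed.

Lemma wsum_bound (R : realType) (N : nat) (p f : 'I_N -> R) (M : R) :
  (forall i, 0 < p i) -> (forall i, `|f i| <= M) ->
  `|\sum_i p i * f i| <= (\sum_i p i) * M.
Proof.
move=> p0 fM; apply: le_trans (ler_norm_sum _ _ _) _.
rewrite mulr_suml; apply: ler_sum => i _.
by rewrite normrM gtr0_norm // ler_pM2l.
Qed.

(* The negative [Y]-part comes from
   [- T w ^ 2 Y - dGam Y <= - mu Y]; large [A] absorbs the [X]-part. *)
Lemma strict_lyapunov (R : realType) (kv c K wb T mu G : R) :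
  0 < kv -> 0 < c -> 0 < K -> 0 < wb -> 0 < T -> 0 < mu -> 0 < G ->
  exists A c0 : R, [/\ 0 < A, 0 < c0 &
    forall X Y S Z E w dw Gam dGam : R,
      0 <= X -> 0 <= Y ->
      (forall eps, 0 < eps -> `|S| <= eps * Y + X / (4 * eps)) ->
      (forall eps, 0 < eps -> `|Z| <= eps * Y + K * X / (4 * eps)) ->
      c * X <= E -> `|w| <= wb -> `|dw| <= wb -> `|Gam| <= G ->
      mu - T * w ^+ 2 <= dGam ->
      [/\ A * (- (2 * kv * E))
            - T * (dw * S + w * (- (kv * Z) + w * Y - w * X))
            - (dGam * Y - 2 * Gam * w * S) <= - (c0 * (X + Y)),
          X + Y <= A * (X + Y) - T * (w * S) - Gam * Y
        & A * (X + Y) - T * (w * S) - Gam * Y <= 2 * A * (X + Y)]].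
Proof.
move=> kv0 c_gt0 K0 wb0 T0 mu0 G0.
(* [a1] and [a2] bound the coefficients of [|S|] and [|Z|], where [S] stands for [x^T P y] and [Z]
   for [(H x)^T P y]. *)
pose a1 := T * wb + 2 * G * wb; pose a2 := T * wb * kv.
have a10 : 0 < a1 by rewrite /a1 addr_gt0 // !mulr_gt0.
have a20 : 0 < a2 by rewrite /a2 !mulr_gt0.
(* With this [ep] the Young inequalities cost [mu / 4] of the damping in [Y]; [b] collects what they
   and [T * w ^+ 2 * X] cost in [X]. *)
pose ep := mu / (4 * (a1 + a2)).
have ep0 : 0 < ep by rewrite divr_gt0 // mulr_gt0 // addr_gt0.
pose b := (a1 + a2 * K) / (4 * ep) + T * wb ^+ 2.
have b0 : 0 < b.
  apply: addr_gt0; last by rewrite mulr_gt0 // exprn_gt0.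
  by apply: divr_gt0; [apply: addr_gt0 => //; exact: mulr_gt0|exact: mulr_gt0].
(* The first summand makes the dissipation in [X] at least [(b + 1) * X]; the second dominates the
   indefinite terms of [W], so that [W >= X + Y]. *)
pose A := (b + 1) / (2 * kv * c) + (T * wb + G + 1).
have A0 : 0 < A.
  by rewrite /A !addr_gt0 // ?divr_gt0 ?mulr_gt0 // addr_gt0.
pose c0 := Num.min 1 (mu / 2).
have c01 : c0 <= 1 by rewrite ge_min lexx.
have c0mu : c0 <= mu / 2 by rewrite ge_min lexx orbT.
exists A, c0; split=> //; first by rewrite lt_min ltr01 divr_gt0.
move=> X Y S Z E w dw Gam dGam X0 Y0 hS hZ hE hw hdw hG hdG.
have AE : 2 * kv * A * (c * X) <= 2 * kv * A * E.
  by rewrite ler_wpM2l // !mulr_ge0 ?ltW.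
have Ac : 2 * kv * A * c >= b + 1.
  have -> : 2 * kv * A * c = b + 1 + 2 * kv * c * (T * wb + G + 1).
    by rewrite /A; field; rewrite !gt_eqF.
  by rewrite lerDl !mulr_ge0 ?ltW // !addr_gt0 ?mulr_gt0.
have AcX : (b + 1) * X <= 2 * kv * A * c * X by exact: ler_wpM2r.
have Tdw : `|T * dw * S| <= T * wb * `|S|.
  by rewrite normM_le // normM_le // gtr0_norm.
have Gw : `|2 * Gam * w * S| <= 2 * G * wb * `|S|.
  by rewrite !normM_le // ger0_norm.
have Tw : `|T * w * kv * Z| <= T * wb * kv * `|Z|.
  by rewrite !normM_le // gtr0_norm.
have wX : T * w ^+ 2 * X <= T * wb ^+ 2 * X.
  rewrite ler_wpM2r // ler_pM2l // -real_normK ?num_real //.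
  by rewrite lerXn2r ?nnegrE ?(ltW wb0).
have GY : (mu - T * w ^+ 2) * Y <= dGam * Y by exact: ler_wpM2r.
have S1 : (T * wb + 2 * G * wb) * `|S| <= a1 * (ep * Y + X / (4 * ep)).
  by rewrite ler_pM2l // hS.
have Z1 : a2 * `|Z| <= a2 * (ep * Y + K * X / (4 * ep)).
  by rewrite ler_pM2l // hZ.
have bE : b * X = a1 * (X / (4 * ep)) + a2 * (K * X / (4 * ep)) + T * wb ^+ 2 * X.
  by rewrite /b; field; rewrite gt_eqF.
have epE : a1 * (ep * Y) + a2 * (ep * Y) = mu / 4 * Y.
  by rewrite /ep; field; rewrite gt_eqF // addr_gt0.
have c0X := ler_wpM2r X0 c01.
have c0Y := ler_wpM2r Y0 c0mu.
have muY : 0 <= mu * Y by rewrite mulr_ge0 // ltW.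
have n1 := ler_norm (- (T * dw * S)); rewrite normrN in n1.
have n2 := ler_norm (2 * Gam * w * S).
have n3 := ler_norm (T * w * kv * Z).
have S2 : `|S| <= (X + Y) / 2.
  by apply: le_trans (hS (1 / 2) _) _; [rewrite divr_gt0|lra].
have TwS : `|T * (w * S)| <= T * (wb * ((X + Y) / 2)).
  by rewrite !normM_le // gtr0_norm.
have GamY : `|Gam * Y| <= G * Y by rewrite normM_le // ger0_norm.
have XY0 : 0 <= X + Y by exact: addr_ge0.
have AXY : (T * wb + G + 1) * (X + Y) <= A * (X + Y).
  rewrite ler_wpM2r // /A lerDr; apply: divr_ge0; first by rewrite ltW // addr_gt0.
  by rewrite !mulr_ge0 // ltW.
have GX : 0 <= G * X by rewrite mulr_ge0 // ltW.
have TXY : 0 <= T * wb * (X + Y) by rewrite !mulr_ge0 // ltW.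
move: TwS; rewrite ler_norml => /andP[t1 t2].
move: GamY; rewrite ler_norml => /andP[g1 g2].
split.
- rewrite expr2 in wX GY; rewrite /a1 in S1 epE bE; rewrite /a2 in Z1 epE bE *.
  lra.
- lra.
- lra.
Qed.

(** * Energy and Lyapunov identities for the vector field with held feedback *)

Section Interval.
Variables (R : realType) (N : nat) (H : 'M[R]_N) (p : 'I_N -> R) (kv : R).
Hypotheses (p0 : forall i, 0 < p i) (kv0 : 0 < kv).
Implicit Types (x y e u : 'I_N -> R).

Definition energy x y : R := \sum_i p i * x i ^+ 2 + \sum_i p i * y i ^+ 2.

Definition lyapunov (A T w Gam : R) x y : R :=
  A * energy x y - T * (w * \sum_i p i * (x i * y i)) - Gam * \sum_i p i * y i ^+ 2.

(** [a] and [b] are the leader's [tildex] and [tildey], [u] is the held angular feedback, and [e] is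
    the hold error [x (t_k) - x t]. Keeping [e] apart presents the field as the continuous-time one
    plus a remainder. *)
Definition xfield (w a b : R) x y e u i : R :=
  - (kv * (mxapp H x i + mxapp H e i)) + (w + u i) * y i + u i * b.

Definition yfield (w a b : R) x y u i : R := - ((w + u i) * x i) - u i * a.

Lemma wsum_ge0 x : 0 <= \sum_i p i * x i ^+ 2.
Proof. by apply: sumr_ge0 => i _; rewrite mulr_ge0 ?sqr_ge0 // ltW. Qed.

Lemma energy_ge0 x y : 0 <= energy x y.
Proof. by rewrite addr_ge0 // wsum_ge0. Qed.

Lemma energy_bound : exists2 k : R, 0 < k & forall x y m, 0 <= m ->
  energy x y <= m ^+ 2 -> forall i, `|x i| <= k * m /\ `|y i| <= k * m.
Proof.
have [pm pm0 hpm] := exists_pos_lb p0.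
(* Since [(1 + pm^-1) ^+ 2 >= pm^-1], this constant serves in place of a square root. *)
exists (1 + pm^-1) => [|x y m m0 hE i]; first by rewrite addr_gt0 // invr_gt0.
have aux f : \sum_i p i * f i ^+ 2 <= m ^+ 2 -> `|f i| <= (1 + pm^-1) * m.
  move=> /(weighted_entry_bound p0)/(_ i) h.
  have k0 : 0 < 1 + pm^-1 by rewrite addr_gt0 // invr_gt0.
  rewrite -(@ler_pXn2r _ 2) ?nnegrE ?mulr_ge0 // ?(ltW k0) // real_normK ?num_real //.
  rewrite exprMn; apply: (@le_trans _ _ (pm^-1 * m ^+ 2)).
    rewrite mulrC ler_pdivlMr // mulrC; apply: le_trans h.
    by rewrite ler_wpM2r ?sqr_ge0.
  rewrite ler_wpM2r ?sqr_ge0 // sqrrD expr1n mul1r.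
  have : 0 < pm^-1 by rewrite invr_gt0.
  have := sqr_ge0 pm^-1; rewrite mulr2n; lra.
have := wsum_ge0 x; have := wsum_ge0 y; rewrite /energy in hE.
by split; apply: aux; lra.
Qed.

Let P : R := \sum_i p i.

Let P_ge0 : 0 <= P.
Proof. by apply: sumr_ge0 => i _; exact: ltW. Qed.

(** The gap in each summand is the square [(2 * eps * |y| - |x|) ^+ 2 / (4 * eps)]. The small factor
    sits on [y], whose damping is limited by the excitation, while that of [x] can be scaled up by
    [A]. *)
Lemma wyoung x y eps : 0 < eps ->
  `|\sum_i p i * (x i * y i)|
    <= eps * (\sum_i p i * y i ^+ 2) + (\sum_i p i * x i ^+ 2) / (4 * eps).
Proof.
move=> e0; apply: le_trans (ler_norm_sum _ _ _) _.
rewrite mulr_sumr mulr_suml -big_split /=; apply: ler_sum => i _.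
rewrite normrM (gtr0_norm (p0 i)).
have -> : eps * (p i * y i ^+ 2) + p i * x i ^+ 2 / (4 * eps)
        = p i * (eps * y i ^+ 2 + x i ^+ 2 / (4 * eps)) by field; rewrite gt_eqF.
rewrite ler_pM2l //.
rewrite normrM -subr_ge0.
have -> : eps * y i ^+ 2 + x i ^+ 2 / (4 * eps) - `|x i| * `|y i|
        = (2 * eps * `|y i| - `|x i|) ^+ 2 / (4 * eps).
  rewrite -(real_normK (num_real (y i))) -(real_normK (num_real (x i))).
  by field; rewrite gt_eqF.
by rewrite divr_ge0 ?sqr_ge0 // mulr_ge0 // ltW.
Qed.

(** The rotation terms cancel inside each summand, so [u] survives only in products with the
    leader's position and is never multiplied by a square of the state. *)
Lemma energy_derivE w a b x y e u :
  \sum_i p i * (2 * (x i * xfield w a b x y e u i))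
  + \sum_i p i * (2 * (y i * yfield w a b x y u i))
  = - (2 * kv * \sum_i p i * (x i * mxapp H x i))
    + \sum_i p i * (2 * (u i * (b * x i - a * y i)) - 2 * kv * (x i * mxapp H e i)).
Proof.
rewrite !mulr_sumr -sumrN -!big_split /=; apply: eq_bigr => i _.
by rewrite /xfield /yfield; ring.
Qed.

(** Here the rotation does not cancel but produces [w * (Y - X)]. Multiplied by [- T * w], this is
    the damping of [y] that the energy lacks; the price is a remainder in which [u] multiplies
    squares of the state. *)
Lemma cross_derivE w a b x y e u :
  \sum_i p i * (xfield w a b x y e u i * y i + x i * yfield w a b x y u i)
  = - (kv * \sum_i p i * (mxapp H x i * y i))
    + w * (\sum_i p i * y i ^+ 2) - w * (\sum_i p i * x i ^+ 2)
    + \sum_i p i * (u i * (y i ^+ 2 - x i ^+ 2 + b * y i - a * x i)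
                    - kv * (mxapp H e i * y i)).
Proof.
rewrite !mulr_sumr -!sumrN -!big_split /=; apply: eq_bigr => i _.
by rewrite /xfield /yfield; ring.
Qed.

Lemma ysq_derivE w a b x y u :
  \sum_i p i * (2 * (y i * yfield w a b x y u i))
  = - (2 * w * \sum_i p i * (x i * y i))
    - \sum_i p i * (2 * (u i * (x i * y i + a * y i))).
Proof.
rewrite !mulr_sumr -!sumrN -!big_split /=; apply: eq_bigr => i _.
by rewrite /yfield; ring.
Qed.

Lemma remainder_bounds (h B : R) : 0 < h ->
  (forall x m i, (forall j, `|x j| <= m) -> `|mxapp H x i| <= h * m) ->
  forall (a b : R) x y e u (n ebar ubar : R),
    `|a| <= B -> `|b| <= B ->
    (forall i, `|x i| <= n) -> (forall i, `|y i| <= n) ->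
    (forall i, `|e i| <= ebar) -> (forall i, `|u i| <= ubar) ->
    [/\ `|\sum_i p i * (2 * (u i * (b * x i - a * y i)) - 2 * kv * (x i * mxapp H e i))|
          <= P * (4 * B * ubar * n + 2 * kv * h * (ebar * n)),
        `|\sum_i p i * (u i * (y i ^+ 2 - x i ^+ 2 + b * y i - a * x i)
                    - kv * (mxapp H e i * y i))|
          <= P * (2 * ubar * n ^+ 2 + 2 * B * ubar * n + kv * h * (ebar * n))
      & `|\sum_i p i * (2 * (u i * (x i * y i + a * y i)))|
          <= P * (2 * ubar * n ^+ 2 + 2 * B * ubar * n)].
Proof.
move=> h0 hh a b x y e u n eb ub ha hb hx hy he hu.
have hHe i : `|mxapp H e i| <= h * eb by exact: hh.
have kvn : `|kv| <= kv by rewrite gtr0_norm.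
have two : `|2 : R| <= 2 by rewrite ger0_norm.
split; apply: wsum_bound => // i.
- have h1 : `|2 * (u i * (b * x i - a * y i))| <= 2 * (ub * (B * n + B * n)).
    apply: normM_le => //; apply: normM_le => //.
    by apply: le_trans (ler_normB _ _) _; rewrite lerD // normM_le.
  have h2 : `|2 * kv * (x i * mxapp H e i)| <= 2 * kv * (n * (h * eb)).
    by rewrite !normM_le.
  apply: le_trans (ler_normB _ _) _; lra.
- have h1 : `|u i * (y i ^+ 2 - x i ^+ 2 + b * y i - a * x i)|
            <= ub * (n * n + n * n + B * n + B * n).
    apply: normM_le => //.
    apply: le_trans (ler_normB _ _) _; rewrite lerD ?normM_le //.
    apply: le_trans (ler_normD _ _) _; rewrite lerD ?normM_le //.
    by apply: le_trans (ler_normB _ _) _; rewrite !expr2 lerD ?normM_le.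
  have h2 : `|kv * (mxapp H e i * y i)| <= kv * (h * eb * n).
    by rewrite !normM_le.
  apply: le_trans (ler_normB _ _) _; rewrite expr2; lra.
- have h1 : `|2 * (u i * (x i * y i + a * y i))| <= 2 * (ub * (n * n + B * n)).
    apply: normM_le => //; apply: normM_le => //.
    by apply: le_trans (ler_normD _ _) _; rewrite lerD // normM_le.
  rewrite expr2; lra.
Qed.

Lemma is_derive_wsq (f : 'I_N -> R -> R) (df : 'I_N -> R) (t : R) :
  (forall i, is_derive t 1 (f i) (df i)) ->
  is_derive t 1 (fun s => \sum_i p i * f i s ^+ 2)
                (\sum_i p i * (2 * (f i t * df i))).
Proof.
move=> hf; apply: (is_derive_eq (is_derive_wsum p (fun i => is_derive_mul (hf i) (hf i)))).
by apply: eq_bigr => i _; ring.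
Qed.

Lemma is_derive_energy (x y : 'I_N -> R -> R) (dx dy : 'I_N -> R) (t : R) :
  (forall i, is_derive t 1 (x i) (dx i)) -> (forall i, is_derive t 1 (y i) (dy i)) ->
  is_derive t 1 (fun s => energy (x^~ s) (y^~ s))
    (\sum_i p i * (2 * (x i t * dx i)) + \sum_i p i * (2 * (y i t * dy i))).
Proof. by move=> hx hy; apply: is_deriveD; exact: is_derive_wsq. Qed.

Lemma is_derive_lyapunov (A T : R) (w Gam : R -> R) (dw dGam : R)
    (x y : 'I_N -> R -> R) (dx dy : 'I_N -> R) (t : R) :
  is_derive t 1 w dw -> is_derive t 1 Gam dGam ->
  (forall i, is_derive t 1 (x i) (dx i)) -> (forall i, is_derive t 1 (y i) (dy i)) ->
  is_derive t 1 (fun s => lyapunov A T (w s) (Gam s) (x^~ s) (y^~ s))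
    (A * (\sum_i p i * (2 * (x i t * dx i)) + \sum_i p i * (2 * (y i t * dy i)))
     - T * (dw * (\sum_i p i * (x i t * y i t))
            + w t * \sum_i p i * (dx i * y i t + x i t * dy i))
     - (dGam * (\sum_i p i * y i t ^+ 2)
        + Gam t * \sum_i p i * (2 * (y i t * dy i)))).
Proof.
move=> hw hG hx hy.
have h1 := is_derive_energy hx hy.
have h2 := is_derive_wsum p (fun i => is_derive_mul (hx i) (hy i)).
have h3 := is_derive_mul hG (is_derive_wsq hy).
have h4 := is_derive_mul hw h2.
by apply: is_deriveB h3; apply: is_deriveB; exact: is_deriveZ.
Qed.

Lemma within_continuous_energy (D : set R) (x y : 'I_N -> R -> R) :
  (forall i, {within D, continuous x i}) -> (forall i, {within D, continuous y i}) ->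
  {within D, continuous (fun s => energy (x^~ s) (y^~ s))}.
Proof.
move=> hx hy s.
by apply: cvgD; apply: continuous_wsum => i; exact: within_continuousM.
Qed.

Lemma within_continuous_lyapunov (D : set R) (A T : R) (w Gam : R -> R)
    (x y : 'I_N -> R -> R) :
  {within D, continuous w} -> {within D, continuous Gam} ->
  (forall i, {within D, continuous x i}) -> (forall i, {within D, continuous y i}) ->
  {within D, continuous (fun s => lyapunov A T (w s) (Gam s) (x^~ s) (y^~ s))}.
Proof.
move=> hw hG hx hy s.
apply: cvgB; first apply: cvgB.
- by apply: cvgM; [exact: cvg_cst|exact: within_continuous_energy].
- apply: cvgM; first exact: cvg_cst.
  by apply: cvgM; [exact: hw|apply: continuous_wsum => i; exact: within_continuousM].
- by apply: cvgM; [exact: hG|apply: continuous_wsum => i; exact: within_continuousM].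
Qed.

End Interval.

(** * Estimates over one sampling interval *)

Section Segment.
Variables (R : realType) (N : nat) (H : 'M[R]_N) (kv : R).

Definition segment_solution (w a b : R -> R) (s0 s1 : R) (x y : 'I_N -> R -> R)
    (u : 'I_N -> R) : Prop :=
  [/\ forall i, {within `[s0, s1], continuous x i},
      forall i, {within `[s0, s1], continuous y i}
    & forall t, s0 < t -> t < s1 -> forall i,
      is_derive t 1 (x i) (xfield H kv (w t) (a t) (b t) (x^~ t) (y^~ t)
                             (fun j => x j s0 - x j t) u i) /\
      is_derive t 1 (y i) (yfield (w t) (a t) (b t) (x^~ t) (y^~ t) u i)].

End Segment.

(** A maximum argument in place of Gronwall. If [V] is largest at [ts] and
    [M ^+ 2 = V ts + ub ^+ 2], then [|V'| <= C1 * M ^+ 2] on the interval, so a length of at most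
    [1 / (2 * C1)] gives [V ts - V s0 <= M ^+ 2 / 2], that is [M ^+ 2 <= 2 * m ^+ 2]. Including
    [ub ^+ 2] in [m] controls the forcing by the leader's position. *)
Lemma segment_a_priori (R : realType) (N : nat) (H : 'M[R]_N) (p : 'I_N -> R)
    (kv wb B : R) : (forall i, 0 < p i) -> 0 < kv -> 0 < wb -> 0 < B ->
  exists C T1 : R, [/\ 0 < C, 0 < T1 &
    forall (w a b : R -> R) (s0 s1 : R) x y u ub,
      segment_solution H kv w a b s0 s1 x y u ->
      s0 <= s1 -> s1 - s0 <= T1 ->
      (forall t, s0 <= t -> [/\ `|w t| <= wb, `|a t| <= B & `|b t| <= B]) ->
      0 <= ub -> (forall i, `|u i| <= ub) ->
      let m := Num.sqrt (energy p (x^~ s0) (y^~ s0) + ub ^+ 2) in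
      forall t, s0 <= t -> t <= s1 ->
        (forall i, [/\ `|x i t| <= C * m, `|y i t| <= C * m
           & `|x i s0 - x i t| <= C * (s1 - s0) * (1 + ub) * m]) /\
        `|energy p (x^~ t) (y^~ t) - energy p (x^~ s0) (y^~ s0)|
          <= C * (s1 - s0) * m ^+ 2].
Proof.
move=> p0 kv0 wb0 B0; pose P := \sum_i p i.
have P_ge0 : 0 <= P by apply: sumr_ge0 => i _; exact: ltW.
have [h h0 hh] := mxapp_bound H.
have [k k0 hk] := energy_bound p0.
pose C1 := (P + 1) * (4 * B * k + 6 * kv * h * k ^+ 2).
have kk0 : 0 < kv * h * k ^+ 2 by rewrite !mulr_gt0 // exprn_gt0.
have Bk0 : 0 < B * k by rewrite mulr_gt0.
have C10 : 0 < C1 by apply: mulr_gt0; [rewrite ltr_wpDl|lra].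
pose C2 := kv * h * (2 * k) + (wb + 1) * (2 * k) + B.
have C20 : 0 < C2 by rewrite /C2 !addr_gt0 // ?mulr_gt0 // addr_gt0.
exists (2 * k + C2 + 2 * C1), (1 / (2 * C1)).
split; [lra|by rewrite divr_gt0 // mulr_gt0|].
move=> w a b s0 s1 x y u ub [cx cy dxy] s01 sT hwab ub0 hu m.
pose V t := energy p (x^~ t) (y^~ t).
have V0 t : 0 <= V t by exact: energy_ge0.
have cV : {within `[s0, s1], continuous V} by exact: within_continuous_energy.
have [ts] := EVT_max s01 cV; rewrite in_itv /= => /andP[s0t ts1] Vmax.
pose M := Num.sqrt (V ts + ub ^+ 2).
have M0 : 0 <= M by exact: sqrtr_ge0.
have m0 : 0 <= m by exact: sqrtr_ge0.
have ub2 := sqr_ge0 ub.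
have M2 : M ^+ 2 = V ts + ub ^+ 2 by rewrite sqr_sqrtr // addr_ge0.
have m2 : m ^+ 2 = V s0 + ub ^+ 2.
  by apply: sqr_sqrtr; apply: addr_ge0 => //; exact: energy_ge0.
have ubm : ub <= m by rewrite -(@ler_pXn2r _ 2) ?nnegrE // m2; have := V0 s0; lra.
have xyM t : s0 <= t -> t <= s1 -> forall i, `|x i t| <= k * M /\ `|y i t| <= k * M.
  move=> st ts'; apply: hk => //; rewrite -/(V t) M2.
  have : V t <= V ts by apply: Vmax; rewrite in_itv /= st ts'.
  lra.
have mM : m <= M.
  rewrite -(@ler_pXn2r _ 2) ?nnegrE // M2 m2 lerD2r; apply: Vmax.
  by rewrite in_itv /= lexx s01.
have ubM := le_trans ubm mM.
have kM0 : 0 <= k * M by rewrite mulr_ge0 // ltW.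
have dV t (st : s0 < t) (ts' : t < s1) := is_derive_energy p
  (fun i => (dxy t st ts' i).1) (fun i => (dxy t st ts' i).2).
have dVb t : s0 < t -> t < s1 ->
  `|\sum_i p i * (2 * (x i t * xfield H kv (w t) (a t) (b t) (x^~ t) (y^~ t)
                             (fun j => x j s0 - x j t) u i))
   + \sum_i p i * (2 * (y i t * yfield (w t) (a t) (b t) (x^~ t) (y^~ t) u i))|
   <= C1 * M ^+ 2.
  move=> st ts'; rewrite energy_derivE.
  have [wt at' bt] := hwab t (ltW st).
  have xt i := (xyM t (ltW st) (ltW ts') i).1.
  have yt i := (xyM t (ltW st) (ltW ts') i).2.
  have et i : `|x i s0 - x i t| <= k * M + k * M.
    apply: le_trans (ler_normB _ _) _; rewrite lerD ?xt //.
    by have [] := xyM s0 (lexx _) s01 i.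
  have [r1 _ _] := remainder_bounds p0 kv0 h0 hh at' bt xt yt et hu.
  have E1 : `|\sum_i p i * (x i t * mxapp H (x^~ t) i)| <= P * ((k * M) * (h * (k * M))).
    by apply: wsum_bound => // i; rewrite normM_le // hh.
  have E2 : `|2 * kv * (\sum_i p i * (x i t * mxapp H (x^~ t) i))|
            <= 2 * kv * (P * ((k * M) * (h * (k * M)))).
    by rewrite !normM_le // gtr0_norm.
  apply: le_trans (ler_normD _ _) _; rewrite normrN.
  apply: le_trans (lerD E2 r1) _; rewrite -/P.
  have Pk : 0 <= 4 * P * B * (k * M) * (M - ub).
    by rewrite !mulr_ge0 ?subr_ge0 // ltW.
  have k1 : 0 <= (4 * B * k + 6 * kv * h * k ^+ 2) * M ^+ 2.
    by rewrite mulr_ge0 ?sqr_ge0 //; lra.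
  rewrite /C1; move: Pk k1; rewrite !expr2; clear; lra.
have VV t : s0 <= t -> t <= s1 -> `|V t - V s0| <= C1 * M ^+ 2 * (s1 - s0).
  move=> st ts'; apply: (@le_trans _ _ (C1 * M ^+ 2 * (t - s0))).
    apply: (mvt_norm (df := fun t =>
     \sum_i p i * (2 * (x i t * xfield H kv (w t) (a t) (b t) (x^~ t) (y^~ t)
                             (fun j => x j s0 - x j t) u i))
   + \sum_i p i * (2 * (y i t * yfield (w t) (a t) (b t) (x^~ t) (y^~ t) u i)))) => //.
    - by move=> r sr rt; apply: dV => //; exact: lt_le_trans ts'.
    - apply: continuous_subspaceW cV => r /=; rewrite !in_itv /= => /andP[-> rt] /=.
      exact: le_trans ts'.
    - by move=> r sr rt; apply: dVb => //; exact: lt_le_trans ts'.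
  by rewrite ler_wpM2l ?lerD2r // mulr_ge0 ?sqr_ge0 ?ltW.
have C1M : 0 <= C1 * M ^+ 2 by rewrite mulr_ge0 ?sqr_ge0 ?ltW.
have half : C1 * M ^+ 2 * (s1 - s0) <= M ^+ 2 / 2.
  apply: le_trans (ler_wpM2l C1M sT) _.
  rewrite le_eqVlt; apply/orP; left; apply/eqP; field; by rewrite gt_eqF.
have Mm : M ^+ 2 <= 2 * m ^+ 2.
  have := VV ts s0t ts1; rewrite ler_norml => /andP[_ v2].
  rewrite m2; clear - v2 half M2; lra.
have M2m : M <= 2 * m.
  rewrite -(@ler_pXn2r _ 2) ?nnegrE ?mulr_ge0 // exprMn.
  have := sqr_ge0 m; lra.
have kMm : k * M <= 2 * k * m.
  by rewrite -mulrA [X in _ <= X]mulrCA ler_pM2l.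
have sm0 : 0 <= s1 - s0 by rewrite subr_ge0.
have C2m : 0 <= C2 * m by rewrite mulr_ge0 // ltW.
have C1m : 0 <= C1 * m by rewrite mulr_ge0 // ltW.
have km : 0 <= k * m by rewrite mulr_ge0 // ltW.
move=> t st ts'; split=> [i|]; first split.
- have [xt _] := xyM t st ts' i; clear - xt kMm C1m C2m; lra.
- have [_ yt] := xyM t st ts' i; clear - yt kMm C1m C2m; lra.
- rewrite distrC.
  have cx' : {within `[s0, t], continuous x i}.
    apply: continuous_subspaceW (cx i) => r /=; rewrite !in_itv /= => /andP[-> rt] /=.
    exact: le_trans ts'.
  have dx' r : s0 < r -> r < t -> is_derive r 1 (x i) (xfield H kv (w r) (a r) (b r)
      (x^~ r) (y^~ r) (fun j => x j s0 - x j r) u i).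
    by move=> sr rt; have [] := dxy r sr (lt_le_trans rt ts') i.
  have Cum : 0 <= C2 * ((1 + ub) * m).
    by rewrite mulr_ge0 ?(ltW C20) // mulr_ge0 // addr_ge0.
  apply: (@le_trans _ _ (C2 * ((1 + ub) * m) * (t - s0))).
    apply: (mvt_norm _ dx') => // r sr rt.
    have [wr ar br] := hwab r (ltW sr).
    have [_ yr] := xyM r (ltW sr) (ltW (lt_le_trans rt ts')) i.
    (* The feedback acts on the held value [x s0], so current state and hold error recombine and the
       speed is bounded without reference to the hold error itself. *)
    have -> : xfield H kv (w r) (a r) (b r) (x^~ r) (y^~ r)
        (fun j => x j s0 - x j r) u i
      = - (kv * mxapp H (x^~ s0) i) + (w r + u i) * y i r + u i * b r.
      rewrite /xfield -mxappD; congr (- (_ * mxapp H _ _) + _ + _).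
      by apply/funext => j; rewrite addrC subrK.
    have hx : `|mxapp H (x^~ s0) i| <= h * (2 * k * m).
      apply: hh => j; apply: le_trans kMm.
      by have [] := xyM s0 (lexx _) s01 j.
    have h1 : `|- (kv * mxapp H (x^~ s0) i)| <= kv * (h * (2 * k * m)).
      by rewrite normrN normM_le // gtr0_norm.
    have h2 : `|(w r + u i) * y i r| <= (wb + ub) * (2 * k * m).
      apply: normM_le; last exact: le_trans kMm.
      by apply: le_trans (ler_normD _ _) _; rewrite lerD.
    have h3 : `|u i * b r| <= m * B by rewrite normM_le // (le_trans (hu i)).
    apply: le_trans (ler_normD _ _) _; apply: le_trans (lerD (ler_normD _ _) (lexx _)) _.
    apply: le_trans (lerD (lerD h1 h2) h3) _.
    have p1 : 0 <= (kv * h * (2 * k) + wb * (2 * k) + B) * (ub * m).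
      by rewrite !mulr_ge0 // !addr_ge0 // ?mulr_ge0 // ltW.
    rewrite /C2; clear - p1 km; lra.
  have tsm : t - s0 <= s1 - s0 by rewrite lerD2r.
  have := ler_wpM2l Cum tsm.
  have : 0 <= (2 * k + 2 * C1) * ((1 + ub) * m) * (s1 - s0).
    rewrite mulr_ge0 // mulr_ge0 //; last by rewrite mulr_ge0 // addr_ge0.
    by clear - k0 C10; lra.
  clear; lra.
- apply: le_trans (VV t st ts') _.
  have Mms : C1 * (M ^+ 2 * (s1 - s0)) <= C1 * (2 * m ^+ 2 * (s1 - s0)).
    by rewrite ler_pM2l // ler_wpM2r.
  have : 0 <= (2 * k + C2) * (s1 - s0) * m ^+ 2.
    by rewrite !mulr_ge0 ?sqr_ge0 // addr_ge0 ?mulr_ge0 // ltW.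
  clear - Mms; lra.
Qed.

(** [W'] is at most [- c0 * V] plus remainders, all compared with their values at [s0] by the a
    priori estimate. The constant [lam] is [c0 / (4 * A)]: half of the dissipation goes to the
    remainders, and [W <= 2 * A * V] converts the other half into decay of [W]. *)
Lemma lyapunov_step (R : realType) (N : nat) (H : 'M[R]_N) (p : 'I_N -> R)
    (kv c K : R) (w dw Gam dGam a b : R -> R) (wb T mu G B : R) :
  (forall i, 0 < p i) -> 0 < kv -> 0 < c ->
  (forall x, c * (\sum_i p i * x i ^+ 2) <= \sum_i p i * (x i * mxapp H x i)) ->
  0 < K ->
  (forall x, \sum_i p i * mxapp H x i ^+ 2 <= K * \sum_i p i * x i ^+ 2) ->
  [/\ 0 < wb, 0 < T, 0 < mu, 0 < G & 0 < B] ->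
  (forall t, 0 <= t -> [/\ `|a t| <= B, `|b t| <= B,
     is_derive t 1 w (dw t) & is_derive t 1 Gam (dGam t)] /\
     [/\ `|w t| <= wb, `|dw t| <= wb, `|Gam t| <= G & mu - T * w t ^+ 2 <= dGam t]) ->
  exists A C lam T1 : R, [/\ 0 < C, 0 < lam, 0 < T1, lam * T1 <= 1 / 2 &
    let W t := lyapunov p A T (w t) (Gam t) in
    (forall t x y, 0 <= t -> energy p x y <= W t x y <= C * energy p x y) /\
    forall s0 s1 x y u ub,
      0 <= s0 -> s0 <= s1 -> s1 - s0 <= T1 ->
      segment_solution H kv w a b s0 s1 x y u ->
      0 <= ub -> (forall i, `|u i| <= ub) ->
      let W0 := W s0 (x^~ s0) (y^~ s0) in
      W s1 (x^~ s1) (y^~ s1)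
        <= (1 - lam * (s1 - s0)) * W0 + C * (ub * W0 + ub ^+ 2 + ub ^+ 3) /\
      forall t, s0 <= t -> t <= s1 ->
        energy p (x^~ t) (y^~ t)
          <= C * (energy p (x^~ s0) (y^~ s0) + ub ^+ 2)].
Proof.
move=> p0 kv0 c_gt0 hc K0 hK [wb0 T0 mu0 G0 B0] hw.
pose P := \sum_i p i.
have P_ge0 : 0 <= P by apply: sumr_ge0 => i _; exact: ltW.
have [h h0 hh] := mxapp_bound H.
have [A [c0 [A0 c00 hA]]] := strict_lyapunov kv0 c_gt0 K0 wb0 T0 mu0 G0.
have [C1 [T1' [C10 T1'0 hap]]] := segment_a_priori H p0 kv0 wb0 B0.
pose W t := lyapunov p A T (w t) (Gam t).
have hW t x y : 0 <= t ->
    energy p x y <= W t x y <= 2 * A * energy p x y /\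
    A * (- (2 * kv * \sum_i p i * (x i * mxapp H x i)))
      - T * (dw t * (\sum_i p i * (x i * y i)) + w t *
          (- (kv * \sum_i p i * (mxapp H x i * y i)) + w t * (\sum_i p i * y i ^+ 2)
           - w t * (\sum_i p i * x i ^+ 2)))
      - (dGam t * (\sum_i p i * y i ^+ 2)
         - 2 * Gam t * w t * (\sum_i p i * (x i * y i)))
      <= - (c0 * energy p x y).
  move=> t0; have [_ [hwt hdw hG hdG]] := hw t t0.
  have [||||q1 q2 q3] := hA (\sum_i p i * x i ^+ 2) (\sum_i p i * y i ^+ 2)
    (\sum_i p i * (x i * y i)) (\sum_i p i * (mxapp H x i * y i))
    (\sum_i p i * (x i * mxapp H x i)) (w t) (dw t) (Gam t) (dGam t) _ _ _ _
    (hc x) hwt hdw hG hdG.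
  - exact: wsum_ge0.
  - exact: wsum_ge0.
  - by move=> eps e0; exact: wyoung.
  - move=> eps e0; apply: le_trans (wyoung p0 _ _ e0) _.
    by rewrite lerD2l ler_wpM2r ?hK // invr_ge0 mulr_ge0 // ltW.
  by rewrite q2 q3.
pose D := P * (4 * B + 2 * kv * h + 2).
have D0 : 0 <= D.
  by rewrite mulr_ge0 // !addr_ge0 // ?mulr_ge0 // ltW.
pose C2 := C1 + 2 * C1 ^+ 2.
have C1C1 : 0 < C1 ^+ 2 by rewrite exprn_gt0.
have C20 : 0 < C2 by rewrite /C2; clear - C10 C1C1; lra.
pose C3 := c0 * C1 + (A + T * wb + G) * (D * C2) + 1.
have AG0 : 0 < A + T * wb + G by rewrite !addr_gt0 // mulr_gt0.
have C30 : 0 < C3.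
  apply: ltr_wpDl => //; apply: addr_ge0; first exact: mulr_ge0 (ltW c00) (ltW C10).
  exact: mulr_ge0 (ltW AG0) (mulr_ge0 D0 (ltW C20)).
pose lam := c0 / (4 * A).
have lam0 : 0 < lam by rewrite divr_gt0 // mulr_gt0.
(* In order: the a priori estimate, lengths at most 1, absorption of the hold error by a quarter of
   the dissipation, and [lam * T1 <= 1 / 2]. *)
pose T1 := Num.min (Num.min T1' 1) (Num.min (c0 / (4 * C3)) (1 / (2 * lam))).
have C430 : 0 < 4 * C3 by rewrite mulr_gt0.
pose C4 := c0 / 2 + C3 ^+ 2 / c0 + C3.
have C3c : 0 < C3 ^+ 2 / c0 by rewrite divr_gt0 // exprn_gt0.
have C40 : 0 < C4 by rewrite /C4; clear - c00 C3c C30; lra.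
exists A, (2 * A + C4 + (1 + C1)), lam, T1; split.
- clear - A0 C40 C10; lra.
- exact: lam0.
- by rewrite !lt_min T1'0 ltr01 !divr_gt0 // mulr_gt0.
- apply: (@le_trans _ _ (lam * (1 / (2 * lam)))).
    by rewrite ler_pM2l // !ge_min lexx !orbT.
  by rewrite le_eqVlt; apply/orP; left; apply/eqP; field; rewrite gt_eqF.
move=> W'; rewrite {}/W' -/W; split.
  move=> t x y t0; have [/andP[-> w2] _] := hW t x y t0.
  apply: le_trans w2 _; have E0 := energy_ge0 p0 x y.
  by rewrite ler_wpM2r // -addrA lerDl ltW //; clear - C40 C10; lra.
move=> s0 s1 x y u ub s00 s01 sT sol ub0 hu.
have sm0 : 0 <= s1 - s0 by rewrite subr_ge0.
have sT1' : s1 - s0 <= T1' by apply: le_trans sT _; rewrite !ge_min lexx.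
have s11 : s1 - s0 <= 1 by apply: le_trans sT _; rewrite !ge_min lexx orbT.
have sC3 : s1 - s0 <= c0 / (4 * C3).
  by apply: le_trans sT _; rewrite !ge_min lexx !orbT.
have hwab t : s0 <= t -> [/\ `|w t| <= wb, `|a t| <= B & `|b t| <= B].
  by move=> st; have [[? ? _ _] [? _ _ _]] := hw t (le_trans s00 st).
have ap := hap w a b s0 s1 x y u ub sol s01 sT1' hwab ub0 hu.
set m := Num.sqrt _ in ap.
pose V t := energy p (x^~ t) (y^~ t).
have V0 t : 0 <= V t by exact: energy_ge0.
have m0 : 0 <= m by exact: sqrtr_ge0.
have m2 : m ^+ 2 = V s0 + ub ^+ 2.
  by apply: sqr_sqrtr; apply: addr_ge0; rewrite ?energy_ge0 ?sqr_ge0.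
have ubsq := sqr_ge0 ub.
have m2ge0 := sqr_ge0 m.
have C1m2 : C1 * (s1 - s0) * m ^+ 2 <= C1 * m ^+ 2.
  by rewrite ler_wpM2r // ler_piMr // ltW.
pose W0 := W s0 (x^~ s0) (y^~ s0).
rewrite -[lyapunov p A T (w s0) _ _ _]/W0.
rewrite -[lyapunov p A T (w s1) _ _ _]/(W s1 (x^~ s1) (y^~ s1)).
have W0V := hW s0 (x^~ s0) (y^~ s0) s00; rewrite -/W0 in W0V.
have {W0V} [/andP[VW0 W0V] _] := W0V; rewrite -/(V s0) in VW0 W0V.
split; last first.
  move=> t st ts1; have [_] := ap t st ts1.
  rewrite ler_norml -/(V t) -/(V s0) => /andP[_ vt].
  have : 0 <= (2 * A + C4) * (V s0 + ub ^+ 2).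
    by apply: mulr_ge0; [clear - A0 C40; lra|exact: addr_ge0 (V0 s0) ubsq].
  rewrite -/(V t) -/(V s0); rewrite m2 in C1m2 vt.
  clear - vt C1m2 ubsq; lra.
have [cx cy dxy] := sol.
have wc (f df : R -> R) : (forall t : R, 0 <= t -> is_derive t 1 f (df t)) ->
    {within `[s0, s1], continuous f}.
  move=> dff; apply: continuous_in_subspaceT => t; rewrite inE /= in_itv /=.
  by move=> /andP[st _]; apply: is_derive_continuous (dff t (le_trans s00 st)).
have cw : {within `[s0, s1], continuous w} by apply: wc => t t0; have [[]] := hw t t0.
have cG : {within `[s0, s1], continuous Gam} by apply: wc => t t0; have [[]] := hw t t0.
(* All remainders reduce to three shapes: forcing [q1], bilinear feedback [q2] and hold error [q3].
   [C2] is large enough for the single quantity [Q] to dominate [ub * n], [ub * n ^+ 2] and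
   [eb * n]. *)
pose q1 := ub * m; pose q2 := ub * m ^+ 2; pose q3 := (s1 - s0) * m ^+ 2.
have q10 : 0 <= q1 by rewrite mulr_ge0.
have q20 : 0 <= q2 by rewrite mulr_ge0.
have q30 : 0 <= q3 by rewrite mulr_ge0.
pose Q := C2 * (q1 + q2 + q3).
have Q0 : 0 <= Q by apply: mulr_ge0 (ltW C20) _; rewrite !addr_ge0.
pose n := C1 * m; pose eb := C1 * (s1 - s0) * (1 + ub) * m.
have C1q i : 0 <= i -> 0 <= C1 * i by move=> i0; exact: mulr_ge0 (ltW C10) i0.
have C1qq i : 0 <= i -> 0 <= C1 ^+ 2 * i by move=> i0; exact: mulr_ge0 (ltW C1C1) i0.
have a1 := C1q _ q10; have a2 := C1q _ q20; have a3 := C1q _ q30.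
have b1 := C1qq _ q10; have b2 := C1qq _ q20; have b3 := C1qq _ q30.
have unQ : ub * n <= Q.
  rewrite (_ : ub * n = C1 * q1); last by rewrite /n /q1; ring.
  by rewrite /Q /C2; clear - a1 a2 a3 b1 b2 b3; lra.
have unnQ : ub * n ^+ 2 <= Q.
  rewrite (_ : ub * n ^+ 2 = C1 ^+ 2 * q2); last by rewrite /n /q2; ring.
  by rewrite /Q /C2; clear - a1 a2 a3 b1 b2 b3; lra.
have enQ : eb * n <= Q.
  apply: (@le_trans _ _ (C1 ^+ 2 * (q3 + q2))).
    rewrite (_ : eb * n = C1 ^+ 2 * (q3 + (s1 - s0) * q2)); last first.
      by rewrite /eb /n /q2 /q3; ring.
    by rewrite ler_pM2l // lerD2l ler_piMl.
  by rewrite /Q /C2; clear - a1 a2 a3 b1 b2 b3; lra.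
have step : W s1 (x^~ s1) (y^~ s1) - W s0 (x^~ s0) (y^~ s0)
    <= (- (c0 * V s0) + C3 * (q1 + q2 + q3)) * (s1 - s0).
  have dW t (st : s0 < t) (ts : t < s1) :=
    let hwt := hw t (le_trans s00 (ltW st)) in
    is_derive_lyapunov p A T
      (let: conj (And4 _ _ h _) _ := hwt in h) (let: conj (And4 _ _ _ h) _ := hwt in h)
      (fun i => (dxy t st ts i).1) (fun i => (dxy t st ts i).2).
  apply: (mvt_le s01 dW); first exact: within_continuous_lyapunov.
  move=> t st ts; rewrite energy_derivE cross_derivE ysq_derivE.
  have [xyt vt] := ap t (ltW st) (ltW ts).
  have [[ta tb _ _] [tw _ tG _]] := hw t (le_trans s00 (ltW st)).
  have xt i : `|x i t| <= n by have [] := xyt i.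
  have yt i : `|y i t| <= n by have [] := xyt i.
  have et i : `|x i s0 - x i t| <= eb by have [] := xyt i.
  have [r1 r2 r3] := remainder_bounds p0 kv0 h0 hh ta tb xt yt et hu.
  rewrite -/P in r1 r2 r3.
  have B2 : 0 <= 2 * B by rewrite mulr_ge0 // ltW.
  have kvh : 0 <= kv * h by rewrite mulr_ge0 // ltW.
  have BQ := ler_wpM2l B2 unQ.
  have kQ := ler_wpM2l kvh enQ.
  have kQ0 := mulr_ge0 kvh Q0.
  have BQ0 := mulr_ge0 B2 Q0.
  have DQ z : z <= (4 * B + 2 * kv * h + 2) * Q -> P * z <= D * Q.
    by move=> hz; rewrite /D -mulrA; exact: ler_wpM2l.
  have e1 : 4 * B * ub * n + 2 * kv * h * (eb * n) <= (4 * B + 2 * kv * h + 2) * Q.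
    by clear - BQ kQ kQ0 BQ0 Q0; lra.
  have e2 : 2 * ub * n ^+ 2 + 2 * B * ub * n + kv * h * (eb * n)
          <= (4 * B + 2 * kv * h + 2) * Q.
    by clear - BQ kQ kQ0 BQ0 Q0 unnQ; lra.
  have e3 : 2 * ub * n ^+ 2 + 2 * B * ub * n <= (4 * B + 2 * kv * h + 2) * Q.
    by clear - BQ kQ kQ0 BQ0 Q0 unnQ; lra.
  have {e1}r1 := le_trans r1 (DQ _ e1).
  have {e2}r2 := le_trans r2 (DQ _ e2).
  have {e3}r3 := le_trans r3 (DQ _ e3).
  have [_ Qt] := hW t (x^~ t) (y^~ t) (le_trans s00 (ltW st)).
  rewrite -/(V t) in Qt; move: vt; rewrite -/(V t) -/(V s0) ler_norml => /andP[vt _].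
  set E1 := \sum_i _ in Qt r1 r2 r3 *.
  move: r1 r2 r3.
  set r1 := \sum_i p i * (2 * (u i * (b t * _ - _)) - _).
  set r2 := \sum_i p i * (u i * (_ - _ + _ - _) - _).
  set r3 := \sum_i p i * (2 * (u i * (_ + _))).
  move=> h1 h2 h3.
  have {}h1 : A * r1 <= A * (D * Q).
    by rewrite ler_pM2l // (le_trans (ler_norm _)).
  have {}h2 : `|T * (w t * r2)| <= T * (wb * (D * Q)).
    by rewrite !normM_le // gtr0_norm.
  have {}h3 : `|Gam t * r3| <= G * (D * Q) by rewrite normM_le.
  move: h2 h3; rewrite !ler_norml => /andP[h2 h2'] /andP[h3 h3'].
  have cV : c0 * (V s0 - C1 * q3) <= c0 * V t.
    by rewrite ler_pM2l // /q3; clear - vt; lra.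
  have c0C1 : 0 <= c0 * C1 * (q1 + q2) by rewrite !mulr_ge0 ?addr_ge0 // ltW.
  rewrite /C3; rewrite /Q in h1 h2 h3'.
  clear - h1 h2 h2' h3 h3' cV c0C1 Qt q10 q20 q30; lra.
have c0n : c0 != 0 by rewrite gt_eqF.
(* The forcing is split by completing a square and [q3] is small by the choice of [T1]; each costs
   [c0 / 4 * m ^+ 2]. The term [q2] is not absorbed: as [ub * V s0 + ub ^+ 3] it passes into the
   recursion. *)
have q1b : C3 * q1 <= c0 / 4 * m ^+ 2 + C3 ^+ 2 / c0 * ub ^+ 2.
  rewrite -subr_ge0 (_ : _ - _ = (c0 / 2 * m - C3 * ub) ^+ 2 / c0); last first.
    by rewrite /q1; field.
  by rewrite divr_ge0 ?sqr_ge0 // ltW.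
have q3b : C3 * q3 <= c0 / 4 * m ^+ 2.
  have -> : C3 * q3 = ((s1 - s0) * C3) * m ^+ 2 by rewrite /q3; ring.
  rewrite ler_wpM2r //; move: sC3; rewrite ler_pdivlMr //; clear; lra.
have lamE : c0 / 2 * V s0 >= lam * W0.
  have -> : c0 / 2 * V s0 = lam * (2 * A * V s0) by rewrite /lam; field; rewrite gt_eqF.
  by rewrite ler_pM2l.
have q2E : q2 = ub * V s0 + ub ^+ 3 by rewrite /q2 m2; ring.
have ubW : ub * V s0 <= ub * W0 by rewrite ler_wpM2l.
have W00 : 0 <= W0 := le_trans (V0 s0) VW0.
have ub3 : 0 <= ub ^+ 3 by rewrite exprn_ge0.
have ubW0 : 0 <= ub * W0 by rewrite mulr_ge0.
pose Z := ub * W0 + ub ^+ 2 + ub ^+ 3.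
have Z0 : 0 <= Z by rewrite /Z; clear - ubW0 ubsq ub3; lra.
have bound : - (c0 * V s0) + C3 * (q1 + q2 + q3) <= - (lam * W0) + C4 * Z.
  have t1 : C3 * (ub * V s0) <= C3 * (ub * W0) by rewrite ler_pM2l.
  have t2 : 0 <= (c0 / 2 + C3 ^+ 2 / c0) * (ub * W0 + ub ^+ 3).
    apply: mulr_ge0; [clear - c00 C3c; lra|exact: addr_ge0].
  have t3 : 0 <= C3 * ub ^+ 2 by rewrite mulr_ge0 // ltW.
  rewrite q2E m2 in q1b q3b *; rewrite /C4 /Z.
  clear - t1 t2 t3 q1b q3b lamE; lra.
have := le_trans step (ler_wpM2r sm0 bound); rewrite -/W0 => fin.
have t4 : (s1 - s0) * (C4 * Z) <= C4 * Z.
  by rewrite ler_piMl // mulr_ge0 // ltW.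
have t5 : 0 <= (2 * A + (1 + C1)) * Z by apply: mulr_ge0 => //; clear - A0 C10; lra.
rewrite -/Z; clear - fin t4 t5; lra.
Qed.

(** * Decay of the error system *)

Section DiscreteDecay.
Variable R : realType.

Lemma geometric_sum_le (r : R) (n : nat) : 0 < r -> r < 1 ->
  \sum_(j < n) r ^+ j <= (1 - r)^-1.
Proof.
move=> r0 r1; have d0 : 0 < 1 - r by rewrite subr_gt0.
rewrite -[leRHS]mul1r ler_pdivlMr // mulrC.
have -> : (1 - r) * \sum_(j < n) r ^+ j = 1 - r ^+ n.
  by have := subrX1 r n; lra.
by rewrite gerBl exprn_ge0 // ltW.
Qed.

(* With [S k] the partial sums of [r ^ j], the sequence
   [W k / q ^ k] is bounded by
   [exp (C U S k / q) * (W 0 + C (U ^ 2 + U ^ 3) S k / q)]. *)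
Lemma perturbed_geometric_decay (W u : nat -> R) (C U s r q : R) :
  0 < C -> 0 <= U -> 0 < r -> r <= q -> s <= q -> q < 1 ->
  (forall k, 0 <= W k) -> (forall k, 0 <= u k <= U * r ^+ k) ->
  (forall k, W k.+1 <= s * W k + C * (u k * W k + u k ^+ 2 + u k ^+ 3)) ->
  let K := C / (q * (1 - r)) in
  forall k, W k <= q ^+ k * expR (K * U) * (W 0 + K * (U ^+ 2 + U ^+ 3)).
Proof.
move=> C0 U0 r0 rq sq q1 W0 hu hW K.
have q0 : 0 < q := lt_le_trans r0 rq.
have r1 : r < 1 := le_lt_trans rq q1.
pose S n := \sum_(j < n) r ^+ j.
have S0 n : 0 <= S n by apply: sumr_ge0 => j _; rewrite exprn_ge0 // ltW.
pose c := C / q.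
have c0 : 0 < c by rewrite divr_gt0.
pose U23 := U ^+ 2 + U ^+ 3.
have U230 : 0 <= U23 by rewrite addr_ge0 // exprn_ge0.
have claim k : W k <= q ^+ k * expR (c * U * S k) * (W 0 + c * U23 * S k).
  elim: k => [|k IH].
    by rewrite /S big_ord0 !mulr0 expR0 expr0 !mul1r addr0.
  have SS : S k.+1 = S k + r ^+ k by rewrite /S big_ord_recr.
  have rk : 0 < r ^+ k by rewrite exprn_gt0.
  have qk : 0 < q ^+ k by rewrite exprn_gt0.
  have rk1 : r ^+ k <= 1 by rewrite exprn_ile1 // ltW.
  have rqk : r ^+ k <= q ^+ k by rewrite lerXn2r ?nnegrE // ltW.
  have /andP[uk0 uk] := hu k.
  have h1 : s * W k <= q * W k by rewrite ler_wpM2r.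
  have h2 : u k * W k <= U * r ^+ k * W k by rewrite ler_wpM2r.
  (* Of the two factors [r ^+ k], one is weakened to [q ^+ k], to be factored out, and the other is
     kept to be summed. *)
  have h3 : u k ^+ 2 <= U ^+ 2 * (q ^+ k * r ^+ k).
    apply: (@le_trans _ _ ((U * r ^+ k) ^+ 2)).
      by rewrite lerXn2r ?nnegrE // mulr_ge0 // ltW.
    rewrite exprMn ler_wpM2l ?sqr_ge0 // expr2.
    by rewrite ler_wpM2r // ltW.
  have h4 : u k ^+ 3 <= U ^+ 3 * (q ^+ k * r ^+ k).
    apply: (@le_trans _ _ ((U * r ^+ k) ^+ 3)).
      by rewrite lerXn2r ?nnegrE // mulr_ge0 // ltW.
    rewrite exprMn ler_wpM2l ?exprn_ge0 // exprS expr2 mulrA.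
    rewrite ler_wpM2r ?(ltW rk) // -[leRHS]mulr1.
    by rewrite ler_pM // ltW.
  (* This turns the product of the factors [1 + c * U * r ^+ k] into the exponential of a geometric
     sum. *)
  have e1 : 1 + c * U * r ^+ k <= expR (c * U * r ^+ k) by exact: expR_ge1Dx.
  pose E := expR (c * U * S k); pose F := expR (c * U * r ^+ k).
  have E1 : 1 <= E.
    by rewrite -expR0 ler_expR; exact: mulr_ge0 (mulr_ge0 (ltW c0) U0) (S0 k).
  have F1 : 1 <= F.
    by rewrite -expR0 ler_expR; exact: mulr_ge0 (mulr_ge0 (ltW c0) U0) (ltW rk).
  have step : W k.+1 <= q * F * W k + C * U23 * (q ^+ k * r ^+ k).
    have := ler_wpM2l (ltW C0) h2; have := ler_wpM2l (ltW C0) h3.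
    have := ler_wpM2l (ltW C0) h4.
    have : q * (1 + c * U * r ^+ k) * W k <= q * F * W k.
      by rewrite ler_wpM2r // ler_pM2l.
    have -> : q * (1 + c * U * r ^+ k) * W k = q * W k + C * (U * r ^+ k * W k).
      by rewrite /c; field; rewrite gt_eqF.
    have := hW k; rewrite /U23; move: h1; clear; lra.
  apply: le_trans step _.
  have -> : q ^+ k.+1 * expR (c * U * S k.+1) * (W 0%N + c * U23 * S k.+1)
          = q * F * (q ^+ k * E * (W 0%N + c * U23 * S k))
            + q * q ^+ k * (E * F) * (c * U23 * r ^+ k).
    by rewrite SS (mulrDr (c * U)) expRD exprS -/E -/F; ring.
  have t1 : q * F * W k <= q * F * (q ^+ k * E * (W 0 + c * U23 * S k)).
    by rewrite ler_wpM2l // mulr_ge0 ?ltW // (lt_le_trans ltr01).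
  have t2 : C * U23 * (q ^+ k * r ^+ k) <= q * q ^+ k * (E * F) * (c * U23 * r ^+ k).
    have -> : C * U23 * (q ^+ k * r ^+ k) = 1 * (q * q ^+ k * (c * U23 * r ^+ k)).
      by rewrite /c; field; rewrite gt_eqF.
    have -> : q * q ^+ k * (E * F) * (c * U23 * r ^+ k)
            = (E * F) * (q * q ^+ k * (c * U23 * r ^+ k)) by ring.
    rewrite ler_wpM2r //; last by rewrite mulr_ege1.
    apply: mulr_ge0; first exact: mulr_ge0 (ltW q0) (ltW qk).
    exact: mulr_ge0 (mulr_ge0 (ltW c0) U230) (ltW rk).
  exact: lerD t1 t2.
move=> k; apply: le_trans (claim k) _.
have Sk : c * S k <= K.
  rewrite /K invfM mulrA -/c ler_pM2l //; exact: geometric_sum_le.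
have K0 : 0 <= K := le_trans (mulr_ge0 (ltW c0) (S0 k)) Sk.
apply: ler_pM.
- by rewrite mulr_ge0 ?expR_ge0 // exprn_ge0 // ltW.
- by apply: addr_ge0 => //; exact: mulr_ge0 (mulr_ge0 (ltW c0) U230) (S0 k).
- rewrite ler_wpM2l ?exprn_ge0 ?(ltW q0) // ler_expR.
  by rewrite mulrAC ler_wpM2r.
- by rewrite lerD2l mulrAC ler_wpM2r.
Qed.

End DiscreteDecay.

Section Decay.
Variables (R : realType) (N : nat).

(* [error_solution] entrywise, with one-sided derivatives at the sampling
   instants dropped; continuity makes them redundant. *)
Definition error_trajectory (H : 'M[R]_N) (kw kv : R) (w0 tx0 ty0 : R -> R)
    (T0 t0 : R) (th x y : 'I_N -> R -> R) : Prop :=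
  (forall i, [/\ continuous_from t0 (th i), continuous_from t0 (x i)
               & continuous_from t0 (y i)]) /\
  forall k t, sampling t0 T0 k < t -> t < sampling t0 T0 k.+1 -> forall i,
    let tk := sampling t0 T0 k in
    let u j := - (kw * mxapp H (th^~ tk) j) in
    [/\ is_derive t 1 (th i) (u i),
        is_derive t 1 (x i) (xfield H kv (w0 t) (tx0 t) (ty0 t) (x^~ t) (y^~ t)
                               (fun j => x j tk - x j t) u i)
      & is_derive t 1 (y i) (yfield (w0 t) (tx0 t) (ty0 t) (x^~ t) (y^~ t) u i)].

Definition sqsum (th x y : 'I_N -> R) : R :=
  \sum_i (th i ^+ 2 + x i ^+ 2 + y i ^+ 2).

Lemma sqsum_ge0 (th x y : 'I_N -> R) : 0 <= sqsum th x y.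
Proof. by apply: sumr_ge0 => i _; rewrite !addr_ge0 ?sqr_ge0. Qed.

Lemma sampling_ge (t0 T0 : R) (k : nat) : 0 < T0 -> t0 <= sampling t0 T0 k.
Proof. by move=> T00; rewrite /sampling lerDl mulr_ge0 // ltW. Qed.

Lemma samplingS (t0 T0 : R) (k : nat) :
  sampling t0 T0 k.+1 = sampling t0 T0 k + T0.
Proof. by rewrite /sampling -natr1; ring. Qed.

Lemma sampling0 (t0 T0 : R) : sampling t0 T0 0 = t0.
Proof. by rewrite /sampling mul0r addr0. Qed.

Lemma weighted_norm_bound (p : 'I_N -> R) : (forall i, 0 < p i) ->
  exists2 k : R, 0 < k & forall x m, 0 <= m ->
    \sum_i p i * x i ^+ 2 <= m ^+ 2 -> forall i, `|x i| <= k * m.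
Proof.
move=> p0; have [k k0 hk] := energy_bound p0; exists k => // x m m0 hx i.
have [] // := hk x (fun=> 0) m m0 _ i.
by rewrite /energy [X in _ + X]big1 ?addr0 // => j _; rewrite expr0n mulr0.
Qed.

Lemma sqsum_bounds (p : 'I_N -> R) : (forall i, 0 < p i) ->
  exists2 k : R, 0 < k & forall th x y,
    \sum_i p i * th i ^+ 2 + energy p x y <= k * sqsum th x y /\
    sqsum th x y <= k * (\sum_i p i * th i ^+ 2 + energy p x y).
Proof.
move=> p0; have [pm pm0 hpm] := exists_pos_lb p0.
have [P P0 hP] := exists_pos_ub p.
exists (P + pm^-1) => [|th x y]; first by rewrite addr_gt0 // invr_gt0.
have pmV : 0 < pm^-1 by rewrite invr_gt0.
have pE : \sum_i p i * th i ^+ 2 + energy p x y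
        = \sum_i p i * (th i ^+ 2 + x i ^+ 2 + y i ^+ 2).
  by rewrite /energy -!big_split /=; apply: eq_bigr => i _; ring.
have s0 i : 0 <= th i ^+ 2 + x i ^+ 2 + y i ^+ 2 by rewrite !addr_ge0 ?sqr_ge0.
rewrite pE /sqsum !mulr_sumr; split; apply: ler_sum => i _.
  rewrite ler_wpM2r //; have := le_trans (ler_norm _) (hP i); lra.
rewrite mulrA -[leLHS]mul1r ler_wpM2r // mulrDl.
have h1 : 1 <= pm^-1 * p i by rewrite mulrC ler_pdivlMr ?mul1r.
have : 0 <= P * p i by rewrite mulr_ge0 // ltW.
lra.
Qed.

(** The headings form an autonomous subsystem whose contraction feeds [u_k] into the perturbed
    recursion for [W]. [K] and [q] are fixed before [t0] and the trajectory, which is the uniformity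
    that stability requires. *)
Lemma error_decay (H : 'M[R]_N) (p : 'I_N -> R) (kw kv c : R) (w0 tx0 ty0 : R -> R)
    (B : R) :
  0 < kw -> 0 < kv -> (forall i, 0 < p i) -> 0 < c ->
  (forall x, c * (\sum_i p i * x i ^+ 2) <= \sum_i p i * (x i * mxapp H x i)) ->
  leader_exciting w0 -> 0 < B ->
  (forall t, 0 <= t -> `|tx0 t| <= B /\ `|ty0 t| <= B) ->
  exists2 Tstar : R, 0 < Tstar &
    forall T0, 0 < T0 -> T0 < Tstar ->
    exists K q : R, [/\ 0 < K, 0 < q, q < 1 &
      forall t0 th x y, 0 <= t0 ->
        error_trajectory H kw kv w0 tx0 ty0 T0 t0 th x y ->
        let r2 := sqsum (th^~ t0) (x^~ t0) (y^~ t0) in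
        forall k t, sampling t0 T0 k <= t -> t <= sampling t0 T0 k.+1 ->
          sqsum (th^~ t) (x^~ t) (y^~ t)
            <= K * r2 * expR (K * Num.sqrt r2) * q ^+ k].
Proof.
move=> kw0 kv0 p0 c_gt0 hc PE B0 hB.
have [w [dw [Gam [dGam [wb [T [mu [G [wb0 T_0 mu0 G0 hw]]]]]]]]] := exciting_weight PE.
have [K1 K10 hK1] := weighted_mxapp_bound H p0.
have [||A [C [lam [T1 [C0 lam0 T10 lamT1 [hW hstep]]]]]] :=
  @lyapunov_step R N H p kv c K1 w dw Gam dGam tx0 ty0 wb T mu G B p0 kv0 c_gt0 hc K10 hK1.
- by [].
- by move=> t t_0; have [[? ? ?] ?] := hw t t_0; have [? ?] := hB t t_0.
have [k0 k00 hk0] := weighted_norm_bound p0.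
have [kp kp0 hkp] := sqsum_bounds p0.
pose W t := lyapunov p A T (w t) (Gam t).
(* [T1] serves the Lyapunov step; the other two bounds give [tau * K1 <= c] for the heading
   contraction and [tau * c < 1 / 2], which keeps the contraction factor positive. *)
exists (Num.min T1 (Num.min (c / (kw * K1)) (1 / (2 * (kw * c))))).
  by rewrite !lt_min T10 !divr_gt0 // !mulr_gt0.
move=> T0 T00; rewrite !lt_min => /and3P[T01 T0c T0k].
pose tau := kw * T0.
have tau0 : 0 < tau by rewrite mulr_gt0.
have tauK : tau * K1 <= c.
  by move: T0c; rewrite ltr_pdivlMr ?mulr_gt0 // /tau => h; apply: ltW; lra.
have tauc : tau * c < 1 / 2.
  by move: T0k; rewrite ltr_pdivlMr ?mulr_gt0 // /tau => h; lra.
have tauc0 : 0 < tau * c by rewrite mulr_gt0.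
(* [r2] contracts the squared heading norm, so its root [r] is the ratio for [u]. *)
pose r2 := 1 - tau * c; pose r := Num.sqrt r2.
have r20 : 0 < r2 by rewrite /r2; lra.
have r21 : r2 < 1 by rewrite /r2; lra.
have r0 : 0 < r by rewrite sqrtr_gt0.
have rr : r ^+ 2 = r2 by rewrite sqr_sqrtr // ltW.
have r1 : r < 1 by rewrite -(@ltr_pXn2r _ 2) ?nnegrE ?(ltW r0) // rr expr1n.
have r2r : r2 <= r by rewrite -rr expr2 ler_piMl // ltW.
pose s := 1 - lam * T0.
have s1 : s < 1 by rewrite /s gtrBl mulr_gt0.
pose q := Num.max s r.
have rq : r <= q by rewrite le_max lexx orbT.
have sq : s <= q by rewrite le_max lexx.
have q1 : q < 1 by rewrite gt_max s1 r1.
have q0 : 0 < q := lt_le_trans r0 rq.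
(* [h1] bounds the feedback by the heading norm at [t_k], [h2] bounds the headings between samples
   by the same norm, and [h3] bounds the initial feedback by [r]. *)
pose h1 := kw * (k0 * Num.sqrt K1).
have h10 : 0 < h1 by rewrite !mulr_gt0 // sqrtr_gt0.
pose h2 := k0 + T0 * h1.
have h20 : 0 < h2 by rewrite addr_gt0 // mulr_gt0.
pose K' := C / (q * (1 - r)).
have K'0 : 0 < K' by rewrite divr_gt0 // mulr_gt0 // subr_gt0.
pose h3 := h1 * Num.sqrt kp.
have h30 : 0 < h3 by rewrite mulr_gt0 // sqrtr_gt0.
pose P := \sum_i p i.
have P0 : 0 <= P by apply: sumr_ge0 => i _; exact: ltW.
pose L := kp * (P * h2 ^+ 2 * kp + C * (C * kp + K' * (2 * h3 ^+ 2) + h1 ^+ 2 * kp)).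
have L0 : 0 <= L.
  apply: mulr_ge0; first exact: ltW.
  apply: addr_ge0; first by rewrite !mulr_ge0 ?sqr_ge0 // ltW.
  apply: mulr_ge0; first exact: ltW.
  apply: addr_ge0; first apply: addr_ge0.
  - exact: mulr_ge0 (ltW C0) (ltW kp0).
  - by apply: mulr_ge0 (ltW K'0) _; rewrite mulr_ge0 ?sqr_ge0.
  - by apply: mulr_ge0 (ltW kp0); exact: sqr_ge0.
have K'h : 0 < (K' + 1) * h3 by rewrite mulr_gt0 // addr_gt0.
exists ((K' + 1) * h3 + L), q; split=> //; first by rewrite ltr_pwDl.
move=> t0 th x y t00 [cont der] rho2.
pose tk k := sampling t0 T0 k.
have tk0 k : 0 <= tk k by rewrite (le_trans t00) // sampling_ge.
have tkS k : tk k <= tk k.+1 by rewrite /tk samplingS lerDl ltW.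
have tkd k : tk k.+1 - tk k = T0 by rewrite /tk samplingS addrC addKr.
have within_tk (f : R -> R) k t : t <= tk k.+1 -> continuous_from t0 f ->
    {within `[tk k, t], continuous f}.
  move=> _; apply: continuous_subspaceW => z /=; rewrite !in_itv /= andbT => /andP[h _].
  by apply: le_trans h; exact: sampling_ge.
pose u k j := - (kw * mxapp H (th^~ (tk k)) j).
pose Th k := \sum_i p i * th i (tk k) ^+ 2.
have Th0 k : 0 <= Th k by exact: wsum_ge0.
(* A held feedback makes the headings affine on the interval; at its right end this is exactly an
   Euler step of length [tau]. *)
have thE k t i : tk k <= t -> t <= tk k.+1 -> th i t - th i (tk k) = u k i * (t - tk k).
  move=> kt tk1; have [cth _ _] := cont i.
  have /andP[g1 g2] : u k i * (t - tk k) <= th i t - th i (tk k) <= u k i * (t - tk k).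
    apply: (mvt_bounds (df := fun=> u k i)) => //.
    - by move=> z kz zt; have [] := der k z kz (lt_le_trans zt tk1) i.
    - exact: within_tk tk1 cth.
    - by move=> z _ _; rewrite lexx.
  by apply/eqP; rewrite eq_le g1 g2.
have ThS k : Th k.+1 <= r2 * Th k.
  rewrite /Th (_ : \sum_i p i * th i (tk k.+1) ^+ 2 =
    \sum_i p i * (th i (tk k) - tau * mxapp H (th^~ (tk k)) i) ^+ 2).
    by apply: euler_contraction => //; exact: ltW.
  apply: eq_bigr => i _; congr (_ * _ ^+ 2).
  have := thE k (tk k.+1) i (tkS k) (lexx _); rewrite tkd /u /tau; lra.
have Thk k : Th k <= r2 ^+ k * Th 0%N.
  elim: k => [|k IH]; first by rewrite mul1r.
  apply: le_trans (ThS k) _; rewrite exprS -mulrA; apply: ler_wpM2l IH; exact: ltW.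
pose ub k := h1 * Num.sqrt (Th k).
have ub0 k : 0 <= ub k by exact: mulr_ge0 (ltW h10) (sqrtr_ge0 _).
have hu k i : `|u k i| <= ub k.
  rewrite normrN /ub /h1 -!mulrA; apply: normM_le; first by rewrite gtr0_norm.
  apply: hk0; first by rewrite mulr_ge0 ?sqrtr_ge0.
  by rewrite exprMn !sqr_sqrtr ?(ltW K10) //; exact: hK1.
have ubk k : ub k <= ub 0%N * r ^+ k.
  rewrite /ub -mulrA; apply: ler_wpM2l; first exact: ltW.
  rewrite -(@ler_pXn2r _ 2) ?nnegrE ?sqrtr_ge0 //; last first.
    by apply: mulr_ge0 (sqrtr_ge0 _) _; rewrite exprn_ge0 // ltW.
  rewrite exprMn !sqr_sqrtr // -exprM mulnC exprM rr mulrC; exact: Thk.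
pose Wk k := W (tk k) (x^~ (tk k)) (y^~ (tk k)).
have EW k := hW (tk k) (x^~ (tk k)) (y^~ (tk k)) (tk0 k).
have Wk0 k : 0 <= Wk k.
  by have /andP[h _] := EW k; apply: le_trans h; exact: energy_ge0.
have seg k : segment_solution H kv w tx0 ty0 (tk k) (tk k.+1) x y (u k).
  split=> [i|i|t kt tk1 i].
  - by have [_ cx _] := cont i; exact: within_tk cx.
  - by have [_ _ cy] := cont i; exact: within_tk cy.
  - have [_ dx dy] := der k t kt tk1 i.
    by have [[-> _ _] _] := hw t (le_trans (tk0 k) (ltW kt)).
have stp k := hstep (tk k) (tk k.+1) x y (u k) (ub k) (tk0 k) (tkS k)
  ltac:(by rewrite tkd ltW) (seg k) (ub0 k) (hu k).
have decay : forall k, Wk k <= q ^+ k * expR (K' * ub 0%N)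
    * (Wk 0%N + K' * (ub 0%N ^+ 2 + ub 0%N ^+ 3)).
  apply: (@perturbed_geometric_decay R Wk ub C (ub 0%N) s r q) => //.
    by move=> k; rewrite ub0 ubk.
  by move=> k; have [h _] := stp k; rewrite tkd in h.
have rho20 : 0 <= rho2 by exact: sqsum_ge0.
pose rho := Num.sqrt rho2.
have [bnd0 _] := hkp (th^~ t0) (x^~ t0) (y^~ t0); rewrite -/rho2 in bnd0.
have tkE0 : tk 0%N = t0 by exact: sampling0.
have Th0b : Th 0%N <= kp * rho2.
  apply: le_trans bnd0; rewrite /Th tkE0 lerDl; exact: energy_ge0.
have E0b : energy p (x^~ t0) (y^~ t0) <= kp * rho2.
  by apply: le_trans bnd0; rewrite lerDr; exact: wsum_ge0.
have W0b : Wk 0%N <= C * kp * rho2.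
  have /andP[_ h] := EW 0%N; apply: le_trans h _; rewrite tkE0 -mulrA.
  by rewrite ler_pM2l.
have U0b : ub 0%N <= h3 * rho.
  rewrite /ub /h3 -mulrA; apply: ler_wpM2l; first exact: ltW.
  by rewrite -sqrtrM ?(ltW kp0) // ler_wsqrtr.
have U2b : ub 0%N ^+ 2 <= h3 ^+ 2 * rho2.
  rewrite -(sqr_sqrtr rho20) -exprMn lerXn2r ?nnegrE //.
  exact: le_trans U0b.
(* Both 1 and [U] are at most [expR U], where [U] is [ub 0], so
   [U ^+ 2 + U ^+ 3 <= 2 * U ^+ 2 * expR U]. The cubic term thus becomes quadratic in [rho] at the
   price of the [+ 1] in the exponent. *)
pose E := expR ((K' + 1) * h3 * rho).
have K'U : expR (K' * ub 0%N) * expR (ub 0%N) <= E.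
  rewrite -expRD ler_expR /E -{2}(mul1r (ub 0%N)) -mulrDl -mulrA ler_wpM2l //.
  by rewrite addr_ge0 // ltW.
have eU1 : 1 <= expR (ub 0%N) by rewrite -expR0 ler_expR.
have eU : ub 0%N <= expR (ub 0%N) by have := expR_ge1Dx (ub 0%N); lra.
have eK1 : 1 <= expR (K' * ub 0%N) by rewrite -expR0 ler_expR mulr_ge0 // ltW.
have E1 : 1 <= E by apply: le_trans K'U; rewrite mulr_ege1.
have E_0 : 0 <= E by rewrite expR_ge0.
move=> k t kt tk1.
have qk : 0 < q ^+ k by rewrite exprn_gt0.
have r2qk : r2 ^+ k <= q ^+ k.
  by rewrite lerXn2r ?nnegrE ?(ltW q0) ?(ltW r20) // (le_trans r2r).
pose Z := q ^+ k * rho2 * E.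
have qr : 0 <= q ^+ k * rho2 by exact: mulr_ge0 (ltW qk) rho20.
have qrZ : q ^+ k * rho2 <= Z by rewrite /Z ler_peMr.
have ThZ : Th k <= kp * Z.
  apply: le_trans (Thk k) _; apply: (@le_trans _ _ (q ^+ k * (kp * rho2))).
    by apply: ler_pM => //; rewrite exprn_ge0 // ltW.
  by rewrite mulrCA ler_pM2l.
have ubkZ : ub k ^+ 2 <= h1 ^+ 2 * (kp * Z).
  by rewrite /ub exprMn sqr_sqrtr // ler_wpM2l ?sqr_ge0.
have WZ : Wk k <= (C * kp + K' * (2 * h3 ^+ 2)) * Z.
  apply: le_trans (decay k) _.
  have b1 : K' * (ub 0%N ^+ 2 + ub 0%N ^+ 3)
      <= K' * (2 * h3 ^+ 2) * rho2 * expR (ub 0%N).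
    rewrite (_ : K' * _ * _ * _ = K' * (2 * (h3 ^+ 2 * rho2 * expR (ub 0%N)))); last by ring.
    apply: ler_wpM2l; first exact: ltW.
    have b2 : ub 0%N ^+ 2 * 1 <= h3 ^+ 2 * rho2 * expR (ub 0%N).
      by apply: ler_pM => //; exact: sqr_ge0.
    have b3 : ub 0%N ^+ 2 * ub 0%N <= h3 ^+ 2 * rho2 * expR (ub 0%N).
      by apply: ler_pM => //; exact: sqr_ge0.
    have -> : ub 0%N ^+ 3 = ub 0%N ^+ 2 * ub 0%N by rewrite exprSr.
    rewrite mulr1 in b2.
    by rewrite mulr_natl mulr2n lerD.
  have b4 : Wk 0%N <= C * kp * rho2 * expR (ub 0%N).
    apply: le_trans W0b _; rewrite ler_peMr //.
    by apply: mulr_ge0 rho20; exact: mulr_ge0 (ltW C0) (ltW kp0).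
  have b5 : Wk 0%N + K' * (ub 0%N ^+ 2 + ub 0%N ^+ 3)
      <= (C * kp + K' * (2 * h3 ^+ 2)) * rho2 * expR (ub 0%N).
    clear - b1 b4; lra.
  have g0 : 0 <= q ^+ k * expR (K' * ub 0%N).
    by apply: mulr_ge0 (ltW qk) _; exact: expR_ge0.
  apply: le_trans (ler_wpM2l g0 b5) _.
  rewrite (_ : q ^+ k * expR (K' * ub 0%N)
      * ((C * kp + K' * (2 * h3 ^+ 2)) * rho2 * expR (ub 0%N))
     = (C * kp + K' * (2 * h3 ^+ 2)) * (q ^+ k * rho2)
     * (expR (K' * ub 0%N) * expR (ub 0%N))); last by ring.
  rewrite (_ : (C * kp + _) * Z = (C * kp + K' * (2 * h3 ^+ 2)) * (q ^+ k * rho2) * E);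
    last by rewrite /Z; ring.
  apply: ler_wpM2l K'U; apply: mulr_ge0 qr; apply: addr_ge0.
    exact: mulr_ge0 (ltW C0) (ltW kp0).
  by apply: mulr_ge0 (ltW K'0) _; rewrite mulr_ge0 ?sqr_ge0.
have tht : \sum_i p i * th i t ^+ 2 <= P * h2 ^+ 2 * (kp * Z).
  apply: (@le_trans _ _ (P * (h2 ^+ 2 * Th k))); last first.
    rewrite -mulrA; apply: ler_wpM2l => //.
    by apply: ler_wpM2l => //; exact: sqr_ge0.
  rewrite /P mulr_suml; apply: ler_sum => i _; rewrite ler_pM2l //.
  have thb : `|th i t| <= h2 * Num.sqrt (Th k).
    have -> : th i t = th i (tk k) + u k i * (t - tk k) by rewrite -thE // addrC subrK.
    apply: le_trans (ler_normD _ _) _.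
    rewrite /h2 mulrDl lerD //.
      by apply: (hk0 (th^~ (tk k))); rewrite ?sqrtr_ge0 ?sqr_sqrtr.
    rewrite -mulrA mulrC; apply: normM_le; last exact: hu.
    by rewrite ger0_norm ?subr_ge0 // -(tkd k) lerD2r.
  rewrite -(sqr_sqrtr (Th0 k)) -exprMn -real_normK ?num_real //.
  by rewrite lerXn2r ?nnegrE //; apply: mulr_ge0 (ltW h20) (sqrtr_ge0 _).
have [_ Et] := stp k; have {}Et := Et t kt tk1.
have EtZ : energy p (x^~ t) (y^~ t)
    <= C * ((C * kp + K' * (2 * h3 ^+ 2) + h1 ^+ 2 * kp) * Z).
  apply: le_trans Et _; rewrite ler_pM2l //.
  have /andP[EWk _] := EW k; rewrite -/(W (tk k)) -/(Wk k) in EWk.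
  clear - EWk WZ ubkZ; lra.
have [_ bndt] := hkp (th^~ t) (x^~ t) (y^~ t).
apply: le_trans bndt _; apply: (@le_trans _ _ (L * Z)).
  rewrite /L -mulrA ler_pM2l //; clear - tht EtZ; lra.
have -> : ((K' + 1) * h3 + L) * rho2 * expR (((K' + 1) * h3 + L) * Num.sqrt rho2) * q ^+ k
   = ((K' + 1) * h3 + L) * (q ^+ k * rho2 * expR (((K' + 1) * h3 + L) * rho)).
  by rewrite -/rho; ring.
apply: ler_pM => //.
- by rewrite /Z mulr_ge0.
- by rewrite lerDr ltW.
- rewrite /Z ler_wpM2l // ler_expR ler_wpM2r ?sqrtr_ge0 //.
  by rewrite lerDl.
Qed.

End Decay.

(** * From geometric decay at the samples to a class KL bound *)

Section Stability.
Variable R : realType.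

Lemma Hmat_diagonal_stability (N : nat) (e : rel 'I_N.+1) (a : 'I_N -> 'I_N.+1 -> R) :
  adjacency_weights e a -> (exists t : rel 'I_N.+1, spanning_tree e ord0 t) ->
  exists2 p : 'I_N -> R, (forall i, 0 < p i) &
    exists2 c : R, 0 < c & forall x,
      c * \sum_i p i * x i ^+ 2 <= \sum_i p i * (x i * mxapp (Hmat a) x i).
Proof.
move=> ha A3; have [q hq] := Hmat_row_positive ha A3.
apply: diagonal_stability hq => i j ij; have [a0 _ _] := ha.
by rewrite mxE (negbTE ij) oppr_le0.
Qed.

Lemma cvg_expR_decay (lam : R) : 0 < lam ->
  expR (- (lam * s)) @[s --> +oo] --> (0 : R).
Proof.
move=> lam0; apply: (@cvg_comp _ _ _ (fun s => lam * s) (fun s => expR (- s)) _ +oo).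
  apply/cvgryPge => A.
  have h : \forall s \near +oo, A / lam <= s by apply: nbhs_pinfty_ge; rewrite num_real.
  by apply: filterS h => s; rewrite ler_pdivrMr // mulrC.
exact: cvgr_expR.
Qed.

Lemma sampling_index (t0 T0 t : R) : 0 < T0 -> t0 <= t ->
  exists k, sampling t0 T0 k <= t < sampling t0 T0 k.+1.
Proof.
move=> T00 t0t; have d0 : 0 <= (t - t0) / T0 by rewrite divr_ge0 ?subr_ge0 // ltW.
exists (Num.truncn ((t - t0) / T0)).
have := truncn_itv d0; rewrite /sampling ler_pdivlMr // ltr_pdivrMr //.
move=> /andP[h1 h2]; apply/andP; split; lra.
Qed.

(** The factor [expR (K * r)] is the trace of the bilinear feedback term: the total feedback is of
    order [r] and enters the gain exponentially, without affecting the rate. *)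
Definition KLbound (K lam r s : R) : R := K * r * expR (K * r) * expR (- (lam * s)).

Lemma KLbound_classKL (K lam : R) : 0 < K -> 0 < lam -> classKL (KLbound K lam).
Proof.
move=> K0 lam0; split.
- apply: continuous_subspaceT => -[r s].
  have c1 : {for (r, s), continuous (fun p : R * R => K * p.1)}.
    by apply: cvgM; [exact: cvg_cst|exact: cvg_fst].
  have c2 : {for (r, s), continuous (fun p : R * R => - (lam * p.2))}.
    by apply: cvgN; apply: cvgM; [exact: cvg_cst|exact: cvg_snd].
  apply: cvgM; first apply: cvgM => //.
  + by apply: (continuous_comp c1); exact: continuous_expR.
  + by apply: (continuous_comp c2); exact: continuous_expR.
- by move=> s s0; rewrite /KLbound mulr0 !mul0r.
- move=> s r r' s0 r_0 rr'; rewrite /KLbound ltr_pM2r ?expR_gt0 //.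
  apply: (@lt_le_trans _ _ (K * r' * expR (K * r))).
    by rewrite ltr_pM2r ?expR_gt0 // ltr_pM2l.
  have r'0 : 0 <= r' by rewrite ltW // (le_lt_trans r_0).
  by rewrite ler_wpM2l ?mulr_ge0 ?(ltW K0) // ler_expR ler_pM2l // ltW.
- move=> r s s' r_0 s0 ss'; rewrite /KLbound ler_wpM2l //.
    by rewrite mulr_ge0 ?expR_ge0 // mulr_ge0 // ltW.
  by rewrite ler_expR lerN2 ler_pM2l.
- move=> r r_0; rewrite /KLbound -[X in _ --> X](mulr0 (K * r * expR (K * r))).
  by apply: cvgM; [exact: cvg_cst|exact: cvg_expR_decay].
Qed.

Lemma error_exponential_decay (N : nat) (H : 'M[R]_N) (p : 'I_N -> R) (kw kv c : R)
    (w0 tx0 ty0 : R -> R) (B : R) :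
  0 < kw -> 0 < kv -> (forall i, 0 < p i) -> 0 < c ->
  (forall x, c * (\sum_i p i * x i ^+ 2) <= \sum_i p i * (x i * mxapp H x i)) ->
  leader_exciting w0 -> 0 < B ->
  (forall t, 0 <= t -> `|tx0 t| <= B /\ `|ty0 t| <= B) ->
  exists2 Tstar : R, 0 < Tstar &
    forall T0, 0 < T0 -> T0 < Tstar ->
    exists K lam : R, [/\ 0 < K, 0 < lam &
      forall t0 th x y, 0 <= t0 ->
        error_trajectory H kw kv w0 tx0 ty0 T0 t0 th x y ->
        forall t, t0 <= t ->
          Num.sqrt (sqsum (th^~ t) (x^~ t) (y^~ t))
            <= KLbound K lam (Num.sqrt (sqsum (th^~ t0) (x^~ t0) (y^~ t0))) (t - t0)].
Proof.
move=> kw0 kv0 p0 c0 hc PE B0 hB.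
have [Ts Ts0 h] := error_decay kw0 kv0 p0 c0 hc PE B0 hB.
exists Ts => // T0 T00 T0s; have [K [q [K0 q0 q1 hK]]] := h T0 T00 T0s.
pose mu := - ln q / T0.
have mu0 : 0 < mu by rewrite divr_gt0 // oppr_gt0 ln_lt0 // q0.
(* Taking the square root halves the rate. Here [K2 ^+ 2] must dominate [K / q], which follows from
   [K2 >= 1] and [K2 >= K / q]; [K2 >= K] settles the exponent. *)
pose K2 := K + K / q + 1.
have Kq : 0 < K / q by rewrite divr_gt0.
have K20 : 0 < K2 by rewrite /K2; lra.
exists K2, (mu / 2); split=> //; first by rewrite divr_gt0.
move=> t0 th x y t00 tr t t0t.
set r2 := sqsum (th^~ t0) _ _; pose r := Num.sqrt r2.
have r20 : 0 <= r2 by exact: sqsum_ge0.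
have r0 : 0 <= r by exact: sqrtr_ge0.
have [k /andP[tk tk1]] := sampling_index T00 t0t.
have := hK t0 th x y t00 tr k t tk (ltW tk1); rewrite -/r2 -/r => bnd.
have Kr0 : 0 <= K2 * r by rewrite mulr_ge0 // ltW.
rewrite -(@ler_pXn2r _ 2) ?nnegrE ?sqrtr_ge0 //; last first.
  by rewrite /KLbound !mulr_ge0 ?expR_ge0 // ltW.
rewrite sqr_sqrtr ?sqsum_ge0 //; apply: le_trans bnd _.
(* Time [t] lies before sample [k.+1], not sample [k], so passing to continuous time costs one
   factor [q^-1]. *)
have qk : q ^+ k <= q^-1 * expR (- (mu * (t - t0))).
  rewrite -(ler_pM2l q0) mulrA mulfV ?gt_eqF // mul1r -exprS.
  rewrite -[in leLHS](lnK (_ : q \is Num.pos)) ?posrE // -expRM_natr ler_expR.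
  have -> : ln q = - (mu * T0) by rewrite /mu divfK ?gt_eqF // opprK.
  have : mu * (t - t0) <= mu * (k.+1%:R * T0).
    rewrite ler_pM2l //; move: tk1; rewrite /sampling; clear; lra.
  clear; lra.
rewrite /KLbound -/r !exprMn sqr_sqrtr // -!expRM_natr.
have -> : - (mu / 2 * (t - t0)) * 2 = - (mu * (t - t0)) by field.
apply: (@le_trans _ _ (K * r2 * expR (K * r) * (q^-1 * expR (- (mu * (t - t0)))))).
  by rewrite ler_wpM2l // !mulr_ge0 ?expR_ge0 // ltW.
rewrite [leLHS](_ : _ = (K / q * r2) * expR (K * r) * expR (- (mu * (t - t0))));
  last by ring.
rewrite ler_wpM2r ?expR_ge0 //; apply: ler_pM; rewrite ?expR_ge0 //.
- by rewrite mulr_ge0 // ltW.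
- rewrite ler_wpM2r //; apply: (@le_trans _ _ (K2 * 1)).
    by rewrite mulr1 /K2; lra.
  by rewrite expr2 ler_pM2l // /K2; lra.
- rewrite ler_expR -/r; have : K * r <= K2 * r by rewrite ler_wpM2r // /K2; lra.
  by move: Kr0; clear; lra.
Qed.

Lemma enorm_sqsum (N : nat) (v : 'cV[R]_(N + (N + N))) :
  enorm v = Num.sqrt (sqsum (fun i => usubmx v i ord0)
    (fun i => usubmx (dsubmx v) i ord0) (fun i => dsubmx (dsubmx v) i ord0)).
Proof.
rewrite /enorm /sqsum !big_split_ord /= -!big_split /=; congr Num.sqrt.
by apply: eq_bigr => i _; rewrite !mxE addrA.
Qed.

(** Each feedback term and its hold correction add up to the feedback at the sampled value, and
    [diag (y) H th (t_k)] is the entrywise product of [y] with the held feedback, up to [- kw]. *)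
Lemma error_solution_trajectory (N : nat) (H : 'M[R]_N) (kw kv : R)
    (w0 tx0 ty0 : R -> R) (T0 t0 : R) (z : R -> 'cV[R]_(N + (N + N))) :
  error_solution H kw kv w0 tx0 ty0 T0 t0 z ->
  error_trajectory H kw kv w0 tx0 ty0 T0 t0 (fun i t => usubmx (z t) i ord0)
    (fun i t => usubmx (dsubmx (z t)) i ord0) (fun i t => dsubmx (dsubmx (z t)) i ord0).
Proof.
move=> [cz dz]; split=> [i|k t kt tk1 i tk u].
  split.
  - have := cz (lshift _ i); congr continuous_from.
    by apply/funext => t; rewrite mxE.
  - have := cz (rshift _ (lshift _ i)); congr continuous_from.
    by apply/funext => t; rewrite !mxE.
  - have := cz (rshift _ (rshift _ i)); congr continuous_from.
    by apply/funext => t; rewrite !mxE.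
have Dt : sampling_interval t0 T0 k t by rewrite /sampling_interval /= in_itv /= (ltW kt).
have nD : nbhs t (sampling_interval t0 T0 k).
  apply: nbhs_oo kt tk1 => s; rewrite /sampling_interval /= !in_itv /=.
  by move=> /andP[/ltW -> ->].
have [d1 d2 d3] := dz k t Dt i; rewrite -/tk in d1 d2 d3.
move: (usubmx (z tk)) (usubmx (z t)) (usubmx (dsubmx (z tk))) (usubmx (dsubmx (z t)))
  (dsubmx (dsubmx (z t))) d1 d2 d3 @u => thk thv xk xv yv d1 d2 d3 u.
have hS (v v' : 'cV[R]_N) : \sum_j H i j * (v' - v) j ord0
    = \sum_j H i j * v' j ord0 - \sum_j H i j * v j ord0.
  by rewrite -sumrB; apply: eq_bigr => j _; rewrite !mxE mulrBr.
have hE (v v' : 'cV[R]_N) : mxapp H (fun j => v' j ord0 - v j ord0) i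
    = \sum_j H i j * v' j ord0 - \sum_j H i j * v j ord0.
  by rewrite -sumrB; apply: eq_bigr => j _; rewrite mulrBr.
split.
- apply: (is_derive_eq (deriv_in_is_derive nD d1)).
  by rewrite /u !mxE hS /mxapp; ring.
- apply: (is_derive_eq (deriv_in_is_derive nD d2)).
  rewrite -!mulmxA !mul_diag_mx /xfield /u hE.
  by rewrite !mxE hS /mxapp; ring.
- apply: (is_derive_eq (deriv_in_is_derive nD d3)).
  rewrite -!mulmxA !mul_diag_mx /yfield /u.
  by rewrite !mxE /mxapp; ring.
Qed.

End Stability.

(** * Tracking *)

Section Tracking.
Variable R : realType.

Lemma is_derive_cos_comp (f : R -> R) (t l : R) : is_derive t 1 f l ->
  is_derive t 1 (fun s => cos (f s)) (- sin (f t) * l).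
Proof. by move=> h; apply: (@is_derive1_comp _ cos f). Qed.

Lemma is_derive_sin_comp (f : R -> R) (t l : R) : is_derive t 1 f l ->
  is_derive t 1 (fun s => sin (f s)) (cos (f t) * l).
Proof. by move=> h; apply: (@is_derive1_comp _ sin f). Qed.

(** In the frame turned by the heading, the velocity lies along the first axis. Hence the heading
    drops out and only its rate [w] remains, as a rotation. *)
Lemma is_derive_tilde (x y th : R -> R) (t v w : R) :
  is_derive t 1 x (v * cos (th t)) -> is_derive t 1 y (v * sin (th t)) ->
  is_derive t 1 th w ->
  is_derive t 1 (tildex x y th) (v + w * tildey x y th t) /\
  is_derive t 1 (tildey x y th) (- (w * tildex x y th t)).
Proof.
move=> dx dy dth.
have dc := is_derive_cos_comp dth; have ds := is_derive_sin_comp dth.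
have cs : cos (th t) ^+ 2 + sin (th t) ^+ 2 = 1 by exact: cos2Dsin2.
split.
- apply: (is_derive_eq (is_deriveD (is_derive_mul dx dc) (is_derive_mul dy ds))).
  by rewrite /tildey -[v in RHS]mulr1 -cs; ring.
- have dxN : is_derive t 1 (fun s => - x s) (- (v * cos (th t))) by exact: is_deriveN.
  apply: (is_derive_eq (is_deriveD (is_derive_mul dxN ds) (is_derive_mul dy dc))).
  by rewrite /tildex; ring.
Qed.

Lemma cos_sin_lipschitz (s t : R) :
  `|cos s - cos t| <= `|s - t| /\ `|sin s - sin t| <= `|s - t|.
Proof.
have aux (f df : R -> R) : (forall z : R, is_derive z 1 f (df z)) ->
    (forall z, `|df z| <= 1) -> `|f s - f t| <= `|s - t|.
  move=> hf hdf; have cf : continuous f by move=> z; exact: is_derive_continuous (hf z).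
  wlog st : s t / t <= s => [hw|].
    by have [/hw //|/ltW/hw] := leP t s; rewrite distrC [X in _ <= X]distrC.
  rewrite [X in _ <= X]ger0_norm ?subr_ge0 // -[X in _ <= X]mul1r.
  by apply: (mvt_norm (df := df)) => //; exact: continuous_subspaceT.
split; [apply: (aux cos (fun z => - sin z))|apply: (aux sin cos)] => z.
- by rewrite normrN ler_norml sin_geN1 sin_le1.
- by rewrite ler_norml cos_geN1 cos_le1.
Qed.

(** The differences do not change when the leader's value is subtracted from every node, and the
    leader itself then sits at 0. *)
Lemma sampled_consensusE (N : nat) (a : 'I_N -> 'I_N.+1 -> R) (f0 : R -> R)
    (f : 'I_N -> R -> R) (tk : R) (i : 'I_N) : a i (lift ord0 i) = 0 ->
  sampled_consensus a (with_leader f0 f) tk i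
    = mxapp (Hmat a) (fun j => f j tk - f0 tk) i.
Proof.
move=> aii; rewrite mxapp_Hmat //; apply: eq_bigr => j _; congr (_ * _).
rewrite {1}/with_leader liftK /= /with_leader.
by case: unliftP => [l _|_] /=; ring.
Qed.

Lemma leader_extend (v0 w0 x0 y0 th0 : R -> R) :
  unicycle `[0, +oo[ v0 w0 x0 y0 th0 ->
  exists X Y TH : R -> R, [/\ continuous X, continuous Y, continuous TH &
    forall t : R, 0 <= t ->
      [/\ X t = x0 t, Y t = y0 t & TH t = th0 t] /\
      [/\ is_derive t 1 X (v0 t * cos (TH t)), is_derive t 1 Y (v0 t * sin (TH t))
        & is_derive t 1 TH (w0 t)]].
Proof.
move=> hl.
have hl' t : 0 <= t -> [/\ deriv_in `[0, +oo[ x0 t (v0 t * cos (th0 t)),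
    deriv_in `[0, +oo[ y0 t (v0 t * sin (th0 t)) & deriv_in `[0, +oo[ th0 t (w0 t)].
  by move=> t_0; apply: hl; rewrite /= in_itv /= t_0.
have [X [hX dX]] := @deriv_in_extend R x0 (fun t => v0 t * cos (th0 t))
  (fun t ht => let: And3 h _ _ := hl' t ht in h).
have [Y [hY dY]] := @deriv_in_extend R y0 (fun t => v0 t * sin (th0 t))
  (fun t ht => let: And3 _ h _ := hl' t ht in h).
have [TH [hT dT]] := @deriv_in_extend R th0 w0
  (fun t ht => let: And3 _ _ h := hl' t ht in h).
exists X, Y, TH; split.
- by move=> t; exact: is_derive_continuous (dX t).
- by move=> t; exact: is_derive_continuous (dY t).
- by move=> t; exact: is_derive_continuous (dT t).
move=> t t_0; rewrite hX // hY // hT //; split=> //.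
by have := dX t; have := dY t; have := dT t; rewrite max_r.
Qed.

Lemma continuous_from_eq (t0 : R) (f g : R -> R) : 0 <= t0 ->
  (forall t, 0 <= t -> g t = f t) -> continuous g -> continuous_from t0 f.
Proof.
move=> t00 gf cg; apply: (@subspace_eq_continuous _ _ _ g).
  move=> t; rewrite inE /= in_itv /= andbT => h; apply: gf; exact: le_trans h.
exact: continuous_subspaceT.
Qed.

Lemma continuous_from_tilde (t0 : R) (x y th : R -> R) :
  continuous_from t0 x -> continuous_from t0 y -> continuous_from t0 th ->
  continuous_from t0 (tildex x y th) /\ continuous_from t0 (tildey x y th).
Proof.
move=> cx cy cth.
have cc : continuous_from t0 (fun s => cos (th s)).
  by move=> s; apply: (continuous_comp (cth s)); exact: continuous_cos.
have cs : continuous_from t0 (fun s => sin (th s)).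
  by move=> s; apply: (continuous_comp (cth s)); exact: continuous_sin.
split=> s; apply: cvgD; apply: cvgM; try apply: cvgN.
- exact: cx.
- exact: cc.
- exact: cy.
- exact: cs.
- exact: cx.
- exact: cs.
- exact: cy.
- exact: cc.
Qed.

(** Subtracting the leader's turned-frame equations cancels [v0]. The rotation terms differ by
    [(w0 + u_i) * ty_i - w0 * ty0], which is the rotation of the error plus the forcing [u_i * ty0];
    likewise for the other coordinate. *)
Lemma closed_loop_trajectory (N : nat) (e : rel 'I_N.+1) (a : 'I_N -> 'I_N.+1 -> R)
    (kw kv : R) (v0 w0 x0 y0 th0 : R -> R) (T0 t0 : R) (x y th : 'I_N -> R -> R) :
  adjacency_weights e a -> unicycle `[0, +oo[ v0 w0 x0 y0 th0 ->
  0 <= t0 -> 0 < T0 ->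
  closed_loop a kw kv v0 w0 x0 y0 th0 T0 t0 x y th ->
  error_trajectory (Hmat a) kw kv w0 (tildex x0 y0 th0) (tildey x0 y0 th0) T0 t0
    (fun i t => th i t - th0 t)
    (fun i t => tildex (x i) (y i) (th i) t - tildex x0 y0 th0 t)
    (fun i t => tildey (x i) (y i) (th i) t - tildey x0 y0 th0 t).
Proof.
move=> [_ aii _] hl t00 T00 cl.
have [X [Y [TH [cX cY cTH hX]]]] := leader_extend hl.
have cx0 : continuous_from t0 x0.
  by apply: continuous_from_eq cX => // t /hX[[]].
have cy0 : continuous_from t0 y0.
  by apply: continuous_from_eq cY => // t /hX[[]].
have cth0 : continuous_from t0 th0.
  by apply: continuous_from_eq cTH => // t /hX[[]].
have [ctx0 cty0] := continuous_from_tilde cx0 cy0 cth0.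
split=> [i|k t kt tk1 i tk u].
  have [cx cy cth _] := cl i; have [ctx cty] := continuous_from_tilde cx cy cth.
  split=> s; apply: cvgB.
  - exact: cth.
  - exact: cth0.
  - exact: ctx.
  - exact: ctx0.
  - exact: cty.
  - exact: cty0.
have t_0 : 0 < t by apply: le_lt_trans kt; apply: le_trans t00 _; exact: sampling_ge.
have n0 : nbhs t `[0, +oo[%classic.
  by apply: (@nbhs_oy _ 0) => // s /=; rewrite !in_itv /= !andbT => /ltW.
have Dt : sampling_interval t0 T0 k t by rewrite /sampling_interval /= in_itv /= (ltW kt).
have nD : nbhs t (sampling_interval t0 T0 k).
  apply: nbhs_oo kt tk1 => s; rewrite /sampling_interval /= !in_itv /=.
  by move=> /andP[/ltW -> ->].
have [_ _ _ cli] := cl i.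
have [/(deriv_in_is_derive nD) dx /(deriv_in_is_derive nD) dy
  /(deriv_in_is_derive nD) dth] := cli k t Dt.
have [|/(deriv_in_is_derive n0) dx0 /(deriv_in_is_derive n0) dy0
  /(deriv_in_is_derive n0) dth0] := hl t; first by rewrite /= in_itv /= ltW.
have [dtx dty] := is_derive_tilde dx dy dth.
have [dtx0 dty0] := is_derive_tilde dx0 dy0 dth0.
have uE : - kw * sampled_consensus a (with_leader th0 th) tk i = u i.
  by rewrite sampled_consensusE // /u mulNr.
split.
- apply: (is_derive_eq (is_deriveB dth dth0)); rewrite uE; ring.
- apply: (is_derive_eq (is_deriveB dtx dtx0)).
  rewrite -/tk uE sampled_consensusE // /xfield -mxappD.
  rewrite (_ : (fun j => _ + _) = fun j => tildex (x j) (y j) (th j) tk - tildex x0 y0 th0 tk).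
    by ring.
  by apply/funext => j; ring.
- apply: (is_derive_eq (is_deriveB dty dty0)).
  by rewrite -/tk uE /yfield; ring.
Qed.

Lemma untilde (x y th : R -> R) (t : R) :
  x t = tildex x y th t * cos (th t) - tildey x y th t * sin (th t) /\
  y t = tildex x y th t * sin (th t) + tildey x y th t * cos (th t).
Proof.
have cs : cos (th t) ^+ 2 + sin (th t) ^+ 2 = 1 by exact: cos2Dsin2.
rewrite /tildex /tildey; split.
  by rewrite -[x t in LHS]mulr1 -cs; ring.
by rewrite -[y t in LHS]mulr1 -cs; ring.
Qed.

(** Turning back by [th] instead of [th0] adds to the coordinate errors the leader's coordinates
    times differences of sines and cosines. Boundedness of the leader is what makes these of the
    order of the heading error. *)
Lemma position_error_bound (B : R) (x y th x0 y0 th0 : R -> R) (t d : R) :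
  `|tildex x0 y0 th0 t| <= B -> `|tildey x0 y0 th0 t| <= B ->
  `|th t - th0 t| <= d ->
  `|tildex x y th t - tildex x0 y0 th0 t| <= d ->
  `|tildey x y th t - tildey x0 y0 th0 t| <= d ->
  `|x t - x0 t| <= (2 + 2 * B) * d /\ `|y t - y0 t| <= (2 + 2 * B) * d.
Proof.
have [xE yE] := untilde x y th t; have [x0E y0E] := untilde x0 y0 th0 t.
rewrite [x t]xE [y t]yE [x0 t]x0E [y0 t]y0E.
set tx := tildex x y th t; set ty := tildey x y th t.
set a := tildex x0 y0 th0 t; set b := tildey x0 y0 th0 t.
move=> ha hb hth hx hy.
have [hc hs] := cos_sin_lipschitz (th t) (th0 t).
have {}hc := le_trans hc hth; have {}hs := le_trans hs hth.
have c1 : `|cos (th t)| <= 1 by rewrite ler_norml cos_geN1 cos_le1.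
have s1 : `|sin (th t)| <= 1 by rewrite ler_norml sin_geN1 sin_le1.
have q1 := normM_le hx c1; have q2 := normM_le hy s1.
have q3 := normM_le ha hc; have q4 := normM_le hb hs.
have q5 := normM_le hx s1; have q6 := normM_le hy c1.
have q7 := normM_le ha hs; have q8 := normM_le hb hc.
rewrite ler_norml in q1; rewrite ler_norml in q2; rewrite ler_norml in q3.
rewrite ler_norml in q4; rewrite ler_norml in q5; rewrite ler_norml in q6.
rewrite ler_norml in q7; rewrite ler_norml in q8; rewrite !ler_norml.
move: q1 q2 q3 q4 q5 q6 q7 q8 => /andP[? ?] /andP[? ?] /andP[? ?] /andP[? ?]
  /andP[? ?] /andP[? ?] /andP[? ?] /andP[? ?].
by split; apply/andP; split; lra.
Qed.

Lemma sqsum_entry (N : nat) (th x y : 'I_N -> R) (i : 'I_N) :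
  [/\ `|th i| <= Num.sqrt (sqsum th x y), `|x i| <= Num.sqrt (sqsum th x y)
    & `|y i| <= Num.sqrt (sqsum th x y)].
Proof.
have h : th i ^+ 2 + x i ^+ 2 + y i ^+ 2 <= sqsum th x y.
  rewrite /sqsum (bigD1 i) //= lerDl; apply: sumr_ge0 => j _.
  by rewrite !addr_ge0 ?sqr_ge0.
have := (sqr_ge0 (th i), sqr_ge0 (x i), sqr_ge0 (y i)) => -[[a1 a2] a3].
by rewrite -3!sqrtr_sqr; split; apply: ler_wsqrtr; apply: le_trans h; lra.
Qed.

Lemma tracking_convergence (N : nat) (e : rel 'I_N.+1) (a : 'I_N -> 'I_N.+1 -> R)
    (kw kv B K lam : R) (v0 w0 x0 y0 th0 : R -> R) (T0 t0 : R)
    (x y th : 'I_N -> R -> R) :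
  adjacency_weights e a -> unicycle `[0, +oo[ v0 w0 x0 y0 th0 ->
  0 <= t0 -> 0 < T0 -> 0 < K -> 0 < lam ->
  (forall t, 0 <= t -> `|tildex x0 y0 th0 t| <= B /\ `|tildey x0 y0 th0 t| <= B) ->
  (forall th x y, error_trajectory (Hmat a) kw kv w0 (tildex x0 y0 th0)
                    (tildey x0 y0 th0) T0 t0 th x y ->
     forall t, t0 <= t -> Num.sqrt (sqsum (th^~ t) (x^~ t) (y^~ t))
       <= KLbound K lam (Num.sqrt (sqsum (th^~ t0) (x^~ t0) (y^~ t0))) (t - t0)) ->
  closed_loop a kw kv v0 w0 x0 y0 th0 T0 t0 x y th ->
  forall i, [/\ x i t - x0 t @[t --> +oo] --> (0 : R),
                y i t - y0 t @[t --> +oo] --> (0 : R)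
              & th i t - th0 t @[t --> +oo] --> (0 : R)].
Proof.
move=> ha hl t00 T00 K0 lam0 hB dec cl i.
have {}dec := dec _ _ _ (closed_loop_trajectory ha hl t00 T00 cl).
set r := Num.sqrt (sqsum _ _ _) in dec.
have B0 : 0 <= B by have [h _] := hB t0 t00; apply: le_trans h.
pose d t := KLbound K lam r (t - t0).
have d0 : d t @[t --> +oo] --> (0 : R).
  have -> : d = fun t => K * r * expR (K * r) * expR (lam * t0) * expR (- (lam * t)).
    apply/funext => t; rewrite /d /KLbound.
    rewrite (_ : - (lam * (t - t0)) = lam * t0 + - (lam * t)); last by ring.
    by rewrite expRD mulrA.
  rewrite -[X in _ --> X](mulr0 (K * r * expR (K * r) * expR (lam * t0))).
  by apply: cvgM; [exact: cvg_cst|exact: cvg_expR_decay].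
have D0 : (2 + 2 * B) * d t @[t --> +oo] --> (0 : R).
  by rewrite -[X in _ --> X](mulr0 (2 + 2 * B)); apply: cvgM d0; exact: cvg_cst.
have sq (f : R -> R) : (forall t, t0 <= t -> `|f t| <= (2 + 2 * B) * d t) ->
    f t @[t --> +oo] --> (0 : R).
  move=> hf; apply/norm_cvg0P; apply: (squeeze_cvgr _ (cvg_cst 0) D0).
  have h : \forall t \near +oo, t0 <= t by apply: nbhs_pinfty_ge; rewrite num_real.
  by apply: filterS h => t tt0; rewrite normr_ge0 hf.
have key t : t0 <= t -> [/\ `|x i t - x0 t| <= (2 + 2 * B) * d t,
    `|y i t - y0 t| <= (2 + 2 * B) * d t & `|th i t - th0 t| <= (2 + 2 * B) * d t].
  move=> tt0; have := dec t tt0; rewrite -/(d t) => h.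
  have [e1 e2 e3] := sqsum_entry (fun i => th i t - th0 t)
    (fun i => tildex (x i) (y i) (th i) t - tildex x0 y0 th0 t)
    (fun i => tildey (x i) (y i) (th i) t - tildey x0 y0 th0 t) i.
  have [b1 b2] := hB t (le_trans t00 tt0).
  have e1' := le_trans e1 h.
  have [p1 p2] := position_error_bound b1 b2 e1' (le_trans e2 h) (le_trans e3 h).
  split=> //; apply: le_trans e1' _; rewrite ler_peMl //.
    exact: le_trans (sqrtr_ge0 _) h.
  lra.
by split; apply: sq => t tt0; have [] := key t tt0.
Qed.

End Tracking.

(** * Existence of closed-loop trajectories *)

Section Existence.
Variable R : realType.

(* Integration by parts: [v0] is not assumed integrable, but with
   [phi = th - th0] affine one has
   [v0 * cos th = x0' * cos phi - y0' * sin phi]. *)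
Lemma robot_interval_solution (v0 w0 X Y TH : R -> R) (tk cw cv xk yk thk : R) :
  continuous X -> continuous Y -> continuous TH ->
  (forall t : R, 0 <= t ->
     [/\ is_derive t 1 X (v0 t * cos (TH t)), is_derive t 1 Y (v0 t * sin (TH t))
       & is_derive t 1 TH (w0 t)]) ->
  exists x y th : R -> R, [/\ x tk = xk, y tk = yk, th tk = thk &
    forall t : R, 0 <= t ->
      [/\ is_derive t 1 x ((cv + v0 t) * cos (th t)),
          is_derive t 1 y ((cv + v0 t) * sin (th t)) & is_derive t 1 th (cw + w0 t)]].
Proof.
move=> cX cY cTH hX.
pose phi t := (thk - TH tk) + cw * (t - tk).
pose th t := TH t + phi t.
have dphi (t : R) : is_derive t 1 phi cw.
  have h1 : is_derive t 1 (fun s : R => s - tk) 1 by exact: is_derive_shift.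
  have h2 : is_derive t 1 (fun s : R => cw * (s - tk)) (cw * 1) by exact: is_deriveZ.
  have h3 := is_deriveD (is_derive_cst (thk - TH tk) t 1) h2.
  by apply: (is_derive_eq h3); rewrite add0r mulr1.
have cphi : continuous phi by move=> t; exact: is_derive_continuous (dphi t).
have cth : continuous th by move=> t; apply: cvgD; [exact: cTH|exact: cphi].
have ccos (f : R -> R) : continuous f -> continuous (fun s => cos (f s)).
  by move=> cf s; apply: (continuous_comp (cf s)); exact: continuous_cos.
have csin (f : R -> R) : continuous f -> continuous (fun s => sin (f s)).
  by move=> cf s; apply: (continuous_comp (cf s)); exact: continuous_sin.
have [I1 dI1] : exists F, forall t : R, 0 <= t ->
    is_derive t 1 F (X t * sin (phi t) + Y t * cos (phi t)).
  apply: antiderivative => t; apply: cvgD; apply: cvgM;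
  by [exact: cX|exact: cY|exact: (csin phi)|exact: (ccos phi)].
have [I2 dI2] : exists F, forall t : R, 0 <= t ->
    is_derive t 1 F (Y t * sin (phi t) - X t * cos (phi t)).
  apply: antiderivative => t; apply: cvgB; apply: cvgM;
  by [exact: cX|exact: cY|exact: (csin phi)|exact: (ccos phi)].
have [J1 dJ1] := antiderivative (ccos th cth).
have [J2 dJ2] := antiderivative (csin th cth).
(* Differentiating the turned leader position also produces [phi' = cw] times its turned
   coordinates; [cw * I1] and [cw * I2] cancel these terms, and [cv * J1], [cv * J2] add the
   constant part of the speed. *)
pose g1 t := X t * cos (phi t) - Y t * sin (phi t) + (cw * I1 t + cv * J1 t).
pose g2 t := Y t * cos (phi t) + X t * sin (phi t) + (cw * I2 t + cv * J2 t).
exists (fun t => g1 t + (xk - g1 tk)), (fun t => g2 t + (yk - g2 tk)), th.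
split.
- by rewrite addrCA subrr addr0.
- by rewrite addrCA subrr addr0.
- by rewrite /th /phi; ring.
move=> t t_0; have [dX dY dTH] := hX t t_0.
have dc := is_derive_cos_comp (dphi t); have ds := is_derive_sin_comp (dphi t).
have dZ (c l : R) (f : R -> R) : is_derive t 1 f l -> is_derive t 1 (fun s => c * f s) (c * l).
  by move=> h; exact: is_deriveZ.
have dK (c l : R) (f : R -> R) : is_derive t 1 f l -> is_derive t 1 (fun s => f s + c) l.
  move=> h; apply: (is_derive_eq (is_deriveD h (is_derive_cst c t 1))); exact: addr0.
split.
- apply: dK; apply: (is_derive_eq (is_deriveD
    (is_deriveB (is_derive_mul dX dc) (is_derive_mul dY ds))
    (is_deriveD (dZ cw _ _ (dI1 t t_0)) (dZ cv _ _ (dJ1 t t_0))))).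
  by rewrite /th (cosD (TH t)); ring.
- apply: dK; apply: (is_derive_eq (is_deriveD
    (is_deriveD (is_derive_mul dY dc) (is_derive_mul dX ds))
    (is_deriveD (dZ cw _ _ (dI2 t t_0)) (dZ cv _ _ (dJ2 t t_0))))).
  by rewrite /th (sinD (TH t)); ring.
- by apply: (is_derive_eq (is_deriveD dTH (dphi t))); ring.
Qed.

(** Pieces that agree at the sampling instants are continuous on every finite union of closed
    intervals. This suffices on the half-line, since some sampling instant lies strictly to the
    right of any given time. *)
Lemma glue_intervals (t0 T0 : R) (f : nat -> R -> R) : 0 < T0 ->
  (forall k t, t0 <= t -> {for t, continuous (f k)}) ->
  (forall k, f k (sampling t0 T0 k.+1) = f k.+1 (sampling t0 T0 k.+1)) ->
  exists g, continuous_from t0 g /\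
    forall k t, sampling t0 T0 k <= t -> t <= sampling t0 T0 k.+1 -> g t = f k t.
Proof.
move=> T00 cf ff; pose g t := f (Num.truncn ((t - t0) / T0)) t.
have gE k t : sampling t0 T0 k <= t -> t <= sampling t0 T0 k.+1 -> g t = f k t.
  have idx m s : sampling t0 T0 m <= s < sampling t0 T0 m.+1 -> g s = f m s.
    move=> /andP[h1 h2]; rewrite /g (@truncn_def _ _ m) //.
    rewrite ler_pdivlMr // ltr_pdivrMr //; move: h1 h2; rewrite /sampling => h1 h2.
    by apply/andP; split; lra.
  move=> kt; rewrite le_eqVlt => /predU1P[->|tk1]; last by apply: idx; rewrite kt.
  by rewrite ff; apply: idx; rewrite lexx /= [X in _ < X]samplingS ltrDl.
exists g; split=> //.
have sle k : sampling t0 T0 k <= sampling t0 T0 k.+1 by rewrite samplingS lerDl ltW.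
have cI k : {within `[sampling t0 T0 k, sampling t0 T0 k.+1], continuous g}.
  apply: (@subspace_eq_continuous _ _ _ (f k)).
    by move=> t; rewrite inE /= in_itv /= => /andP[h1 h2]; apply/esym; exact: gE.
  apply: continuous_in_subspaceT => t; rewrite inE /= in_itv /= => /andP[h1 h2].
  by apply: cf; apply: le_trans h1; exact: sampling_ge.
have cU k : {within `[t0, sampling t0 T0 k.+1], continuous g}.
  elim: k => [|k IH]; first by have := cI 0%N; rewrite sampling0.
  have h : {within `[t0, sampling t0 T0 k.+1]
      `|` `[sampling t0 T0 k.+1, sampling t0 T0 k.+2], continuous g}.
    by apply: withinU_continuous => //; exact: interval_closed.
  apply: continuous_subspaceW h => t /=; rewrite !in_itv /= => /andP[h1 h2].
  by have [h3|h3] := leP t (sampling t0 T0 k.+1); [left|right];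
    rewrite ?h1 ?h3 // (ltW h3).
apply/subspace_continuousP => t; rewrite /= in_itv /= andbT => t0t.
have [k /andP[_ tk1]] := sampling_index T00 t0t.
have /subspace_continuousP/(_ t) := cU k.
rewrite /= in_itv /= t0t (ltW tk1) => /(_ isT); apply: cvg_trans; apply: cvg_app => A hA.
have lt1 : \forall s \near t, s < sampling t0 T0 k.+1 by exact: lt_nbhsl.
move: hA; rewrite !nbhs_filterE /within /= => hA.
apply: (@filterS2 _ (nbhs t) _ _ _ _ _ hA lt1) => s h s1.
by rewrite in_itv /= andbT => t0s; apply: h; rewrite in_itv /= t0s ltW.
Qed.

(** Method of steps: the state at a sampling instant fixes constant feedbacks for the whole next
    interval, so the robots decouple there and the end state starts the next interval. *)
Lemma closed_loop_existence (N : nat) (e : rel 'I_N.+1) (a : 'I_N -> 'I_N.+1 -> R)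
    (kw kv : R) (v0 w0 x0 y0 th0 : R -> R) (T0 t0 : R) (xi yi thi : 'I_N -> R) :
  adjacency_weights e a -> unicycle `[0, +oo[ v0 w0 x0 y0 th0 ->
  0 <= t0 -> 0 < T0 ->
  exists x y th, closed_loop a kw kv v0 w0 x0 y0 th0 T0 t0 x y th /\
    forall i, [/\ x i t0 = xi i, y i t0 = yi i & th i t0 = thi i].
Proof.
move=> [_ aii _] hl t00 T00.
have [X [Y [TH [cX cY cTH hX]]]] := leader_extend hl.
have hX' t (h : 0 <= t) := (hX t h).2.
pose state := 'I_N -> R * R * R.
pose cw k (s : state) i := - kw * mxapp (Hmat a) (fun j => (s j).2 - th0 (sampling t0 T0 k)) i.
pose tx (s : state) i := (s i).1.1 * cos (s i).2 + (s i).1.2 * sin (s i).2.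
pose cv k s i := - kv * mxapp (Hmat a)
  (fun j => tx s j - tildex x0 y0 th0 (sampling t0 T0 k)) i.
(* The piece is chosen for every index, start state and robot at once, so that the states at the
   sampling instants obey an ordinary recursion. *)
have step (q : nat * state * 'I_N) : exists F : (R -> R) * (R -> R) * (R -> R),
   let k := q.1.1 in let s := q.1.2 in let i := q.2 in let tk := sampling t0 T0 k in
   (F.1.1 tk, F.1.2 tk, F.2 tk) = s i /\ forall t : R, 0 <= t ->
     [/\ is_derive t 1 F.1.1 ((cv k s i + v0 t) * cos (F.2 t)),
         is_derive t 1 F.1.2 ((cv k s i + v0 t) * sin (F.2 t))
       & is_derive t 1 F.2 (cw k s i + w0 t)].
  case: q => [[k s] i] /=.
  have [x [y [th [hx hy hth der]]]] := robot_interval_solution (sampling t0 T0 k)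
    (cw k s i) (cv k s i) (s i).1.1 (s i).1.2 (s i).2 cX cY cTH hX'.
  by exists (x, y, th); rewrite /= hx hy hth; split=> //; case: (s i) => [[]].
have {step}[F hF] := boolp.choice step.
pose st := fix st k : state := if k is k'.+1 then
    fun i => let G := F (k', st k', i) in let t := sampling t0 T0 k'.+1 in
      (G.1.1 t, G.1.2 t, G.2 t)
  else fun i => (xi i, yi i, thi i).
pose G k i := F (k, st k, i).
have hG0 k i : ((G k i).1.1 (sampling t0 T0 k), (G k i).1.2 (sampling t0 T0 k),
    (G k i).2 (sampling t0 T0 k)) = st k i by have [] := hF (k, st k, i).
have hG k i (t : R) : 0 <= t ->
     [/\ is_derive t 1 (G k i).1.1 ((cv k (st k) i + v0 t) * cos ((G k i).2 t)),
         is_derive t 1 (G k i).1.2 ((cv k (st k) i + v0 t) * sin ((G k i).2 t))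
       & is_derive t 1 (G k i).2 (cw k (st k) i + w0 t)].
  by have [_] := hF (k, st k, i); apply.
have hGS k i : ((G k i).1.1 (sampling t0 T0 k.+1), (G k i).1.2 (sampling t0 T0 k.+1),
    (G k i).2 (sampling t0 T0 k.+1)) = st k.+1 i by [].
have glue (pr : (R -> R) * (R -> R) * (R -> R) -> R -> R) :
    (forall k i t, 0 <= t -> {for t, continuous (pr (G k i))}) ->
    (forall k i, pr (G k i) (sampling t0 T0 k.+1) = pr (G k.+1 i) (sampling t0 T0 k.+1)) ->
    exists g : 'I_N -> R -> R, forall i, continuous_from t0 (g i) /\
      forall k t, sampling t0 T0 k <= t -> t <= sampling t0 T0 k.+1 ->
        g i t = pr (G k i) t.
  move=> cpr hpr.
  have hg i : exists gi : R -> R, continuous_from t0 gi /\ forall k t,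
      sampling t0 T0 k <= t -> t <= sampling t0 T0 k.+1 -> gi t = pr (G k i) t.
    apply: (@glue_intervals t0 T0 (fun k => pr (G k i)) T00) => // k t t0t.
    by apply: cpr; exact: le_trans t0t.
  by have [g hg'] := boolp.choice hg; exists g.
have [|k i|x hx] := glue (fun G => G.1.1).
- by move=> k i t t_0; have [d _ _] := hG k i t t_0; exact: is_derive_continuous d.
- by have := hG0 k.+1 i; rewrite -hGS => -[].
have [|k i|y hy] := glue (fun G => G.1.2).
- by move=> k i t t_0; have [_ d _] := hG k i t t_0; exact: is_derive_continuous d.
- by have := hG0 k.+1 i; rewrite -hGS => -[].
have [|k i|th hth] := glue (fun G => G.2).
- by move=> k i t t_0; have [_ _ d] := hG k i t t_0; exact: is_derive_continuous d.
- by have := hG0 k.+1 i; rewrite -hGS => -[].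
have sle k : sampling t0 T0 k <= sampling t0 T0 k.+1 by rewrite samplingS lerDl ltW.
(* At sampling instants the glued signals equal the recursive states. Hence the feedback computed
   from them is the one with which the pieces were built. *)
have stE k j : (x j (sampling t0 T0 k), y j (sampling t0 T0 k), th j (sampling t0 T0 k))
    = st k j.
  have [_ xE] := hx j; have [_ yE] := hy j; have [_ thE] := hth j.
  by rewrite -hG0 (xE k) ?(yE k) ?(thE k).
exists x, y, th; split=> [thall txall i|i]; last first.
  by have := stE 0%N i; rewrite sampling0 => -[-> -> ->].
have [cx xE] := hx i; have [cy yE] := hy i; have [cth thE] := hth i.
split=> // k tk w v t Dt.
have : sampling t0 T0 k <= t /\ t < sampling t0 T0 k.+1.
  by move: Dt; rewrite /sampling_interval /= in_itv /= => /andP.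
move=> [kt tk1]; have t_0 : 0 <= t.
  by apply: le_trans kt; apply: le_trans t00 _; exact: sampling_ge.
have DE s : sampling_interval t0 T0 k s ->
    [/\ (G k i).1.1 s = x i s, (G k i).1.2 s = y i s & (G k i).2 s = th i s].
  rewrite /sampling_interval /= in_itv /= => /andP[ks sk1].
  by rewrite (xE k) ?(yE k) ?(thE k) // ltW.
have [_ _ thtE] := DE t Dt.
have wE : w t = cw k (st k) i + w0 t.
  rewrite /w sampled_consensusE // /cw; congr (_ * mxapp _ _ _ + _).
  by apply/funext => j; rewrite -stE.
have vE : v t = cv k (st k) i + v0 t.
  rewrite /v sampled_consensusE // /cv; congr (_ * mxapp _ _ _ + _).
  by apply/funext => j; rewrite /tx -stE.
have [d1 d2 d3] := hG k i t t_0; rewrite wE vE -thtE.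
split.
- by apply: (eq_deriv_in _ Dt (is_derive_deriv_in _ d1)) => s /DE[].
- by apply: (eq_deriv_in _ Dt (is_derive_deriv_in _ d2)) => s /DE[].
- by apply: (eq_deriv_in _ Dt (is_derive_deriv_in _ d3)) => s /DE[].
Qed.

End Existence.

Theorem theorem3 (R : realType) (N : nat) (N_ge1 : (1 <= N)%N)
    (kw kv : R) (kw_gt0 : 0 < kw) (kv_gt0 : 0 < kv)
    (e : rel 'I_N.+1) (a : 'I_N -> 'I_N.+1 -> R)
    (ha : adjacency_weights e a)
    (v0 w0 x0 y0 th0 : R -> R)
    (leader : unicycle `[0, +oo[ v0 w0 x0 y0 th0)
    (A1 : leader_bounded x0 y0)
    (A2 : leader_exciting w0)
    (A3 : exists t : rel 'I_N.+1, spanning_tree e ord0 t) :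
  exists2 Tstar : R, 0 < Tstar &
    forall T0 : R, 0 < T0 -> T0 < Tstar ->
      UGAS (error_solution (Hmat a) kw kv w0
              (tildex x0 y0 th0) (tildey x0 y0 th0) T0)
      /\ solves_tracking a kw kv v0 w0 x0 y0 th0 T0.
Proof.
have [p p0 [c c0 hc]] := Hmat_diagonal_stability ha A3.
have [M M0 hM] := A1.
have hB t : 0 <= t ->
    `|tildex x0 y0 th0 t| <= M + M /\ `|tildey x0 y0 th0 t| <= M + M.
  move=> t0; have [hx hy] := hM t t0.
  have c1 : `|cos (th0 t)| <= 1 by rewrite ler_norml cos_geN1 cos_le1.
  have s1 : `|sin (th0 t)| <= 1 by rewrite ler_norml sin_geN1 sin_le1.
  rewrite /tildex /tildey -[M]mulr1.
  split; apply: le_trans (ler_normD _ _) _.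
    by rewrite lerD // normM_le.
  by rewrite lerD // normM_le // normrN.
have MM0 : 0 < M + M by rewrite addr_gt0.
(* A single decay estimate for trajectories of the error equations yields both claims, so one
   threshold serves for stability and for tracking. *)
have [Ts Ts0 hdec] := error_exponential_decay kw_gt0 kv_gt0 p0 c0 hc A2 MM0 hB.
exists Ts => // T0 T00 T0s; have [K [lam [K0 lam0 dec]]] := hdec T0 T00 T0s.
split.
  exists (KLbound K lam); first exact: KLbound_classKL.
  move=> t0 z t00 sol t t0t; rewrite !enorm_sqsum.
  exact: (dec t0 _ _ _ t00 (error_solution_trajectory sol) t t0t).
move=> t0 xi yi thi t00 trajectory; split.
  have [x [y [th [h1 h2]]]] :=
    closed_loop_existence kw kv xi yi thi ha leader t00 T00.
  by exists x, y, th.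
move=> x y th [cl _].
apply: (tracking_convergence ha leader t00 T00 K0 lam0 hB _ cl) => th' x' y' tr.
exact: dec.
Qed.
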